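(* (1) Let $(F,G)$ be a Jacobi pair with $F,G\in\mathcal A[y]$, put $J=[F,G]\in\mathbb C\setminus\{0\}$, and suppose $\mathrm{Res}_x(F\,\partial_xG):=\mathrm{Coeff}(F\,\partial_xG,x^{-1})=0$. Let $x=u(t)$, $y=v(t)$ with $u,v\in\mathbb C((t^{-1}))$. Then $$\mathrm{Res}_t\Big(F\frac{dG}{dt}\Big)=J\,\mathrm{Res}_t\Big(u\frac{dv}{dt}\Big).$$ (2) An element $F\in\mathcal B$ is a Jacobian element if and only if $F\notin\mathbb C$ and $(F-c)^a$ has the vanishing trace property for all $a\in\mathbb Q$ and all $c\in\mathbb C$ (where $(F-c)^a$ might lie in $\mathcal C$ rather than in $\mathcal B$). (3) Let $F\in\mathcal B$ be a Jacobian element and $H\in\mathcal B$. There exists $K\in\mathcal B$ such that $H=[K,F]$ if and only if $HF^a$ has the vanishing trace property for all $a\in\mathbb Q$. (4) Let $(F,G)$ be a Jacobi pair in $\mathcal B$ with $[F,G]=1$. Then $\mathrm{tr}([H,F]G)=\mathrm{tr}\,H$ for every $H\in\mathcal B$.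
   Context: $\mathcal A$ is the field of formal series $f=\sum_{i\in\mathbb Q}f_ix^i$, $f_i\in\mathbb C$, with $\{i: f_i\neq0\}\subset\alpha-\frac1\beta\mathbb Z_+$ for some $\alpha,\beta\in\mathbb Z$, $\beta>0$ (here $\mathbb Z_+=\{0,1,2,\dots\}$). $\mathcal B=\mathcal A((y^{-1}))$ is the set of $F=\sum_{j\in\mathbb Z}F_jy^j$, $F_j\in\mathcal A$, with $\{j:F_j\ne0\}\subset\alpha-\mathbb Z_+$ for some $\alpha\in\mathbb Z$. $\mathcal C$ is the set of $F=\sum_{j\in\mathbb Q}F_jy^j$, $F_j\in\mathcal A$, with $\{j:F_j\neq0\}\subset\alpha-\frac1\beta\mathbb Z_+$ for some $\alpha,\beta\in\mathbb Z$, $\beta>0$. Bracket: $[F,G]=(\partial_xF)(\partial_yG)-(\partial_yF)(\partial_xG)$. Rational powers: for $F=\sum_{i\ge0}f_iy^{m-i}$ with $f_0\ne0$, $F^a=f_0^ay^{am}\big(1+\sum_{i\ge1}f_0^{-1}f_iy^{-i}\big)^a$ by binomial expansion, and for $h=x^\alpha+\sum_{i\ge1}h_ix^{\alpha-i/\beta}\in\mathcal A$, $h^a=x^{a\alpha}(1+\sum_{i\ge1}h_ix^{-i/\beta})^a$ by binomial expansion (a scalar leading coefficient $\lambda\ne0$ contributes a fixed choice of $\lambda^a$). Prime degree: for $F=\sum_{i\ge0}f_iy^{m-i}\in\mathcal B$, $f_0\neq0$, if $p\in\mathbb Q$ satisfies $\deg_xf_i\le\deg_xf_0+pi$ for all $i$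 with equality for at least one $i\ge1$, then $p(F)=p$; $p(F)=-\infty$ if $F=f_0y^m$; $p(F)=+\infty$ if no such $p$ exists otherwise. A Jacobi pair (quasi-Jacobi pair) is a pair $(F,G)$ of elements $F=\sum_{i\ge0}f_iy^{m-i}$, $G=\sum_{j\ge0}g_jy^{n-j}$ of $\mathcal B$, $f_i,g_j\in\mathcal A$, $f_0g_0\ne0$, $m>0$, with $[F,G]\in\mathbb C\setminus\{0\}$, $p(F)\neq\pm\infty$ and $p(G)\le p(F)$. $F\in\mathcal B$ is a Jacobian element if there is $G\in\mathcal B$ with $[F,G]\in\mathbb C\setminus\{0\}$. Trace: $\mathrm{tr}\,F=\mathrm{Res}_x\mathrm{Res}_yF=\mathrm{Coeff}(F,x^{-1}y^{-1})$, the coefficient of $x^{-1}y^{-1}$ (for $F$ in $\mathcal B$ or $\mathcal C$). $F$ has the vanishing trace property if $\mathrm{tr}\,F=0$. In (1), $F$ and $G$ in the conclusion mean $F(u(t),v(t))$, $G(u(t),v(t))$ (rational powers of $u(t)$ being understood by binomial expansion), and $\mathrm{Res}_t$ is the coefficient of $t^{-1}$.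
   Formalization: (3) fails for F=1+x^{-1}, H=x^{-5}y^{-1}: its equivalence is stated when the leading term of F is not a nonzero constant, and for all Jacobian F with (F-c)^a, all c in C, replacing F^a; in (1), F(u,v), G(u,v) are assumed formally defined, and λ^a is additive in a. *)

(* Defs.v *)
From HB Require Import structures.
From mathcomp Require Import all_boot all_order all_algebra.
From mathcomp Require Import ring lra.
From mathcomp Require Import boolp classical_sets functions cardinality fsbigop.
From mathcomp Require Import constructive_ereal reals complex.
Set Implicit Arguments.
Unset Strict Implicit.
Unset Printing Implicit Defensive.
Import Order.TTheory GRing.Theory Num.Theory.
Local Open Scope classical_set_scope.
Local Open Scope ring_scope.

(******************************************************************************)
(* Series sum_i f_i X^i, i in rat, with coefficients in K and support in      *)
(* alpha - (1/beta) Z_+, are used twice: for K the field of complex numbers   *)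
(* they form the field A (series in x), and for K = A they form C (series in  *)
(* y), of which B is the subset of series with integer exponents.             *)
(******************************************************************************)

Definition ramified_by (K : nmodType) (alpha beta : int) (f : rat -> K) : Prop :=
  forall i : rat, f i != 0 ->
    exists n : nat, i = alpha%:~R - n%:R / beta%:~R.

Definition ramified (K : nmodType) (f : rat -> K) : Prop :=
  exists alpha beta : int, 0 < beta /\ ramified_by alpha beta f.

Definition ramified_pred (K : nmodType) : {pred rat -> K} :=
  fun f => `[< ramified f >].

Record puiseux (K : nmodType) := Puiseux {
  coef :> rat -> K;
  coefP : ramified_pred coef }.

HB.instance Definition _ (K : nmodType) := [isSub for @coef K].
HB.instance Definition _ (K : nmodType) := [Equality of puiseux K by <:].
HB.instance Definition _ (K : nmodType) := [Choice of puiseux K by <:].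

Section Zmod.
Variable K : zmodType.

Lemma ramified_by_widen (f : rat -> K) (a a' b c : int) :
  a <= a' -> 0 < b -> 0 < c -> ramified_by a b f -> ramified_by a' (b * c) f.
Proof.
move=> aa' b0 c0 fab i /fab[n ->].
exists (`|((a' - a) * b * c)%R| + n * `|c|)%N.
have b0' : (b%:~R : rat) != 0 by rewrite intr_eq0 gt_eqF.
have c0' : (c%:~R : rat) != 0 by rewrite intr_eq0 gt_eqF.
rewrite natrD natrM !natr_absz (gtr0_norm c0) ger0_norm; last first.
  by rewrite !mulr_ge0 ?subr_ge0 // ltW.
rewrite !(intrM, intrB, intrD).
by field; rewrite b0' c0'.
Qed.

Lemma ramified_common (f g : rat -> K) : ramified f -> ramified g ->
  exists a b : int, [/\ 0 < b, ramified_by a b f & ramified_by a b g].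
Proof.
move=> [a [b [b0 fr]]] [a' [b' [b0' gr]]].
exists (Num.max a a'), (b * b'); split; first by rewrite mulr_gt0.
  by apply: ramified_by_widen fr => //; rewrite le_max lexx.
by rewrite mulrC; apply: ramified_by_widen gr => //; rewrite le_max lexx orbT.
Qed.

Lemma ramified_common3 (f g h : rat -> K) :
  ramified f -> ramified g -> ramified h -> exists a b : int,
  [/\ 0 < b, ramified_by a b f, ramified_by a b g & ramified_by a b h].
Proof.
move=> fr gr [a' [b' [b0' hr]]].
have [a [b [b0 far gar]]] := ramified_common fr gr.
exists (Num.max a a'), (b * b'); split; first by rewrite mulr_gt0.
- by apply: ramified_by_widen far => //; rewrite le_max lexx.
- by apply: ramified_by_widen gar => //; rewrite le_max lexx.
- by rewrite mulrC; apply: ramified_by_widen hr => //; rewrite le_max lexx orbT.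
Qed.

Lemma ramified_zmod_closed : zmod_closed (@ramified_pred K).
Proof.
split=> [|f g /asboolP fr /asboolP gr]; apply/asboolP.
  by exists 0, 1; split=> // i; rewrite eqxx.
have [a [b [b0 far gar]]] := ramified_common fr gr.
exists a, b; split=> // i; rewrite -[(f - g) i]/(f i - g i).
have [fi0|/far//] := eqVneq (f i) 0.
have [gi0|/gar//] := eqVneq (g i) 0.
by rewrite fi0 gi0 subr0 eqxx.
Qed.
End Zmod.

HB.instance Definition _ (K : zmodType) :=
  GRing.isZmodClosed.Build (rat -> K) (@ramified_pred K)
    (@ramified_zmod_closed K).
HB.instance Definition _ (K : zmodType) :=
  [SubChoice_isSubZmodule of puiseux K by <:].

Section Series.
Variable K : zmodType.
Implicit Types (f g : puiseux K) (F : rat -> K).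

Lemma ramifiedP f : ramified f.
Proof. by case: f => f fP; apply/asboolP. Qed.

Lemma puiseuxP f g : f =1 g <-> f = g.
Proof. by split=> [fg|-> //]; apply/val_inj/funext. Qed.

(* The series with coefficients F, or 0 if the support of F is not admissible. *)
Definition Pser F : puiseux K := insubd 0 F.

Lemma PserE F : ramified F -> Pser F =1 F.
Proof. by move=> rF i; rewrite /Pser insubdK //; apply/asboolP. Qed.

Lemma coefD f g i : (f + g) i = f i + g i. Proof. by []. Qed.
Lemma coefN f i : (- f) i = - f i. Proof. by []. Qed.
Lemma coefB f g i : (f - g) i = f i - g i. Proof. by []. Qed.
Lemma coef0 i : (0 : puiseux K) i = 0. Proof. by []. Qed.
Lemma coef_sum (I : Type) (r : seq I) (P : pred I) (E : I -> puiseux K) i :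
  (\sum_(k <- r | P k) E k) i = \sum_(k <- r | P k) E k i.
Proof. by elim/big_rec2: _ => // k x y _ <-. Qed.

Lemma ramified_zero F : (forall i, F i = 0) -> ramified F.
Proof. by move=> F0; exists 0, 1; split=> // i; rewrite F0 eqxx. Qed.

(* c X^d *)
Definition mono (c : K) (d : rat) : puiseux K :=
  Pser (fun i => if i == d then c else 0).

Lemma ramified_mono (c : K) d : ramified (fun i => if i == d then c else 0).
Proof.
exists `|numq d|, (denq d); split; first exact: denq_gt0.
move=> i; case: (eqVneq i d) => [-> _|_]; last by rewrite eqxx.
exists `|(`|numq d| * denq d - numq d)%R|%N.
have d0 : ((denq d)%:~R : rat) != 0 by rewrite intr_eq0 denq_neq0.
rewrite natr_absz [X in X%:~R / _]ger0_norm; last first.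
  rewrite subr_ge0 (le_trans (ler_norm _)) // ler_peMr //.
  by rewrite -gtz0_ge1 denq_gt0.
rewrite intrB intrM -{1}[d]divq_num_den; field.
by rewrite d0.
Qed.

Lemma monoE c d i : mono c d i = if i == d then c else 0.
Proof. exact/PserE/ramified_mono. Qed.

(* Infinite sums: the supports of the E k must lie in one common admissible   *)
(* set, and each exponent may occur in only finitely many E k.                *)
Definition summable (I : choiceType) (E : I -> puiseux K) : Prop :=
  (exists alpha beta : int, 0 < beta /\ forall k, ramified_by alpha beta (E k))
  /\ forall i, finite_set [set k | E k i != 0].

Definition psum (I : choiceType) (E : I -> puiseux K) : puiseux K :=
  Pser (fun i => \sum_(k \in [set: I]) E k i).

Lemma psumE (I : choiceType) (E : I -> puiseux K) : summable E ->
  forall i, psum E i = \sum_(k \in [set: I]) E k i.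
Proof.
move=> [[a [b [b0 Eab]]] _]; apply: PserE; exists a, b; split=> // i.
by case/(@fsbigN1 _ _ _ _ _ _ (fun i k => E k i)) => k _ /Eab.
Qed.

Definition is_deg f (d : rat) : Prop := f d != 0 /\ forall i, d < i -> f i = 0.

Lemma ex_is_deg f : f != 0 -> exists d, is_deg f d.
Proof.
move=> f0; have [a [b [b0 fab]]] := ramifiedP f.
have b0' : 0 < (b%:~R : rat) by rewrite ltr0z.
have exn : exists n : nat, f (a%:~R - n%:R / b%:~R) != 0.
  apply: contra_neqP f0 => /forallNP h; apply/puiseuxP => i; rewrite coef0.
  have [//|fi] := eqVneq (f i) 0; have [n ni] := fab _ fi.
  by have := h n; rewrite -ni fi.
exists (a%:~R - (ex_minn exn)%:R / b%:~R); case: ex_minnP => n fn nmin.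
split=> // i ni; have [//|fi] := eqVneq (f i) 0.
have [m mi] := fab _ fi; move: fi ni; rewrite mi => /nmin nm.
by rewrite ltrD2l ltrN2 ltr_pM2r ?invr_gt0 // ltr_nat ltnNge nm.
Qed.

(* The degree and the leading coefficient of f != 0. *)
Definition pdeg f : rat := xget 0 [set d | is_deg f d].
Definition plc f : K := f (pdeg f).

Lemma pdegP f : f != 0 -> is_deg f (pdeg f).
Proof. by move=> /ex_is_deg [d dP]; rewrite /pdeg; case: xgetP => [x _ //|/(_ d)]. Qed.

End Series.

Section Product.
Variable K : comNzRingType.
Implicit Types (f g h : puiseux K) (F G H : rat -> K) (a b : int).

Definition conv F G (k : rat) : K := \sum_(i \in [set: rat]) F i * G (k - i).

Lemma convC F G : conv F G =1 conv G F.
Proof.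
move=> k; rewrite /conv (reindex_fsbigT (fun i => k - i)) /=.
  by apply: eq_fsbigr => i _; rewrite subKr mulrC.
by exists (fun i => k - i) => i; rewrite subKr.
Qed.

Lemma ramified_by_conv F G a a' b : ramified_by a b F -> ramified_by a' b G ->
  ramified_by (a + a') b (conv F G).
Proof.
move=> Fab Gab k /(@fsbigN1 _ _ _ _ _ _ (fun k i => F i * G (k - i)))[i _ FG].
have [Fi|/Fab[n ni]] := eqVneq (F i) 0; first by rewrite Fi mul0r eqxx in FG.
have [Gi|/Gab[m mi]] := eqVneq (G (k - i)) 0; first by rewrite Gi mulr0 eqxx in FG.
exists (n + m)%N; rewrite -[k](subrK i) mi ni natrD intrD; ring.
Qed.

Lemma ramified_conv F G : ramified F -> ramified G -> ramified (conv F G).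
Proof.
move=> rF rG; have [a [b [b0 Fab Gab]]] := ramified_common rF rG.
by exists (a + a), b; split=> //; exact: ramified_by_conv.
Qed.

Let gp a b (n : nat) : rat := a%:~R - n%:R / b%:~R.

Let ex_bound a b (k : rat) : 0 < b ->
  exists N, forall n, (N <= n)%N -> gp a b n < k.
Proof.
move=> b0; exists (Num.bound `|b%:~R * (a%:~R - k)|) => n Nn.
have b0' : 0 < (b%:~R : rat) by rewrite ltr0z.
rewrite /gp ltrBlDr -ltrBlDl ltr_pdivlMr // mulrC.
apply: le_lt_trans (ler_norm _) _; apply: lt_le_trans (archi_boundP _) _ => //.
by rewrite ler_nat.
Qed.

Let convE F G a b N k : 0 < b -> ramified_by a b F -> ramified_by a b G ->
  (forall n, (N <= n)%N -> gp a b n < k - a%:~R) ->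
  conv F G k = \sum_(n < N) F (gp a b n) * G (k - gp a b n).
Proof.
move=> b0 Fab Gab Nk.
have b0' : 0 < (b%:~R : rat) by rewrite ltr0z.
rewrite /conv -(fsbig_widen (gp a b @` `I_N)) //; last first.
  move=> i [_ iN] /=; have [->|/Fab[n ni]] := eqVneq (F i) 0.
    by rewrite mul0r.
  have [->|/Gab[m mi]] := eqVneq (G (k - i)) 0; first by rewrite mulr0.
  have [nN|Nn] := ltnP n N; first by case: iN; exists n.
  have := Nk _ Nn; rewrite /gp -ni ltrBrDr -ltrBrDl mi ltrBrDr.
  by rewrite gtrDl ltNge divr_ge0 ?ler0n // ltW.
rewrite fsbig_image; last first.
  move=> n m _ _ /addrI/oppr_inj /(mulIf _) /eqP.
  by rewrite invr_eq0 gt_eqF // eqr_nat => /(_ isT)/eqP.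
by rewrite -(fsbig_ord _ _ (fun n => F (gp a b n) * G (k - gp a b n))).
Qed.

Lemma convDl F G H : ramified F -> ramified G -> ramified H ->
  conv (F + G) H =1 conv F H + conv G H.
Proof.
move=> rF rG rH k.
have [a [b [b0 Fab Gab Hab]]] := ramified_common3 rF rG rH.
have [N Nk] := ex_bound a (k - a%:~R) b0.
have FGab : ramified_by a b (F + G).
  move=> i; rewrite -[(F + G) i]/(F i + G i).
  have [->|/Fab//] := eqVneq (F i) 0; have [->|/Gab//] := eqVneq (G i) 0.
  by rewrite addr0 eqxx.
rewrite -[RHS]/(conv F H k + conv G H k) !(@convE _ _ a b N) // -big_split.
by apply: eq_bigr => n _; rewrite /= -mulrDl.
Qed.

Lemma convA F G H : ramified F -> ramified G -> ramified H ->
  conv F (conv G H) =1 conv (conv F G) H.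
Proof.
move=> rF rG rH k.
have [a [b [b0 Fab Gab Hab]]] := ramified_common3 rF rG rH.
have [a' [b' [b0' FGab GHab]]] :=
  ramified_common (ramified_conv rF rG) (ramified_conv rG rH).
pose A : int := Num.max (Num.max a a') 0; pose B : int := b * b'.
have aA : a <= A by rewrite /A !le_max lexx.
have aA' : a' <= A by rewrite /A !le_max lexx orbT.
have A0 : 0 <= A by rewrite le_max lexx orbT.
have B0 : 0 < B by rewrite mulr_gt0.
have FA : ramified_by A B F by exact: ramified_by_widen Fab.
have GA : ramified_by A B G by exact: ramified_by_widen Gab.
have HA : ramified_by A B H by exact: ramified_by_widen Hab.
have FGA : ramified_by A B (conv F G).
  by rewrite /B mulrC; exact: ramified_by_widen FGab.
have GHA : ramified_by A B (conv G H).
  by rewrite /B mulrC; exact: ramified_by_widen GHab.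
have [N Nk] := ex_bound A (k - A%:~R - A%:~R) B0.
have B0' : 0 < (B%:~R : rat) by rewrite ltr0z.
have gpA m : gp A B m <= A%:~R by rewrite gerBl divr_ge0 ?ler0n // ltW.
have A0' : 0 <= (A%:~R : rat) by rewrite ler0z.
have Nk1 n : (N <= n)%N -> gp A B n < k - A%:~R.
  by move=> /Nk /lt_le_trans; apply; rewrite gerBl.
have Nk2 m n : (N <= n)%N -> gp A B n < k - gp A B m - A%:~R.
  by move=> /Nk /lt_le_trans; apply; rewrite lerD2r lerD2l lerN2.
rewrite [RHS]convC !(@convE _ _ A B N) //.
have E1 n : F (gp A B n) * conv G H (k - gp A B n) = \sum_(m < N)
    F (gp A B n) * (H (gp A B m) * G (k - gp A B n - gp A B m)).
  by rewrite convC (@convE H G A B N) ?mulr_sumr // => m; exact: Nk2.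
have E2 n : H (gp A B n) * conv F G (k - gp A B n) = \sum_(m < N)
    H (gp A B n) * (F (gp A B m) * G (k - gp A B n - gp A B m)).
  by rewrite (@convE F G A B N) ?mulr_sumr // => m; exact: Nk2.
under eq_bigr => n _ do rewrite E1; under [RHS]eq_bigr => n _ do rewrite E2.
rewrite exchange_big /=; apply: eq_bigr => n _; apply: eq_bigr => m _.
by rewrite mulrCA -!addrA [- gp A B n + _]addrC.
Qed.

Definition mulP f g : puiseux K := Pser (conv f g).
Definition oneP : puiseux K := mono 1 0.

Lemma mulPE f g : mulP f g =1 conv f g.
Proof. exact: (PserE (ramified_conv (ramifiedP f) (ramifiedP g))). Qed.

Lemma mulPC : commutative mulP.
Proof. by move=> f g; apply/puiseuxP => i; rewrite !mulPE convC. Qed.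

Lemma mulPA : associative mulP.
Proof.
move=> f g h; apply/puiseuxP => i; rewrite !mulPE.
rewrite (funext (mulPE g h)) (funext (mulPE f g)).
by rewrite convA //; exact: ramifiedP.
Qed.

Lemma conv_mono c d F k : conv (mono c d) F k = c * F (k - d).
Proof.
rewrite /conv -(fsbig_widen [set d]) //; last first.
  by move=> i [_ /= /eqP id]; rewrite monoE (negPf id) mul0r.
by rewrite fsbig_set1 monoE eqxx.
Qed.

Lemma mul1P : left_id oneP mulP.
Proof.
by move=> f; apply/puiseuxP => i; rewrite mulPE conv_mono mul1r subr0.
Qed.

Lemma mulPDl : left_distributive mulP +%R.
Proof.
move=> f g h; apply/puiseuxP => i; rewrite coefD !mulPE.
by rewrite -[coef (f + g)]/(coef f + coef g) convDl //; exact: ramifiedP.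
Qed.

Lemma oneP_neq0 : oneP != 0.
Proof.
apply/eqP => /puiseuxP/(_ 0); rewrite monoE eqxx coef0 => /eqP.
by rewrite oner_eq0.
Qed.

HB.instance Definition _ := GRing.Zmodule_isComNzRing.Build (puiseux K)
  mulPA mulPC mul1P mulPDl oneP_neq0.

Lemma coefM f g k : (f * g) k = \sum_(i \in [set: rat]) f i * g (k - i).
Proof. exact: mulPE. Qed.

Lemma coef1 k : (1 : puiseux K) k = if k == 0 then 1 else 0.
Proof. exact: monoE. Qed.

Lemma coef_monoM c d f k : (mono c d * f) k = c * f (k - d).
Proof. by rewrite coefM; exact: conv_mono. Qed.

Lemma monoM (c c' : K) d d' : mono c d * mono c' d' = mono (c * c') (d + d').
Proof.
apply/puiseuxP => k; rewrite coef_monoM !monoE subr_eq [d' + d]addrC.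
by case: ifP => _; rewrite ?mulr0.
Qed.

End Product.

Section Field.
Variable K : fieldType.
Implicit Types (f g e : puiseux K) (b : int).

Let small b e := forall i, e i != 0 -> exists n : nat, i = - (n.+1%:R / b%:~R).

Let small_pow b e : small b e -> forall k i, (e ^+ k) i != 0 ->
  exists n : nat, i = - ((n + k)%:R / b%:~R).
Proof.
move=> se; elim=> [|k IHk] i.
  rewrite expr0 coef1; case: (eqVneq i 0) => [-> _|_]; last by rewrite eqxx.
  by exists 0; rewrite mul0r oppr0.
rewrite exprS coefM => /(@fsbigN1 _ _ _ _ _ _ (fun i j => e j * (e ^+ k) (i - j))).
case=> j _; have [->|/se[n nj]] := eqVneq (e j) 0; first by rewrite mul0r eqxx.
have [->|/IHk[m mj] _] := eqVneq ((e ^+ k) (i - j)) 0.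
  by rewrite mulr0 eqxx.
exists (m + n)%N; rewrite -[ i ](subrK j) mj nj -opprD -mulrDl -natrD.
by rewrite !addnS addnAC.
Qed.

Let neg_small e : (forall i, 0 <= i -> e i = 0) -> exists2 b, 0 < b & small b e.
Proof.
move=> e0; have [a [b [b0 eab]]] := ramifiedP e.
have b0' : 0 < (b%:~R : rat) by rewrite ltr0z.
exists b => // i ei; have [n ni] := eab _ ei.
have i0 : i < 0 by rewrite ltNge; apply: contra_neqN ei => /e0 ->.
have nab : 0 < n%:Z - a * b.
  rewrite subr_gt0 -(ltr_int rat) intrM -ltr_pdivlMr // -subr_lt0.
  by rewrite -[n%:~R]/(n%:R) -ni.
exists `|(n%:Z - a * b)%R|%N.-1; rewrite prednK ?absz_gt0 ?gt_eqF //.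
rewrite natr_absz gtr0_norm // intrB intrM ni -[n%:~R]/(n%:R).
by field; rewrite gt_eqF.
Qed.

Lemma summable_pow (c : nat -> K) e : (forall i, 0 <= i -> e i = 0) ->
  summable (fun k : nat => mono (c k) 0 * e ^+ k).
Proof.
move=> /neg_small[b b0 se].
have b0' : 0 < (b%:~R : rat) by rewrite ltr0z.
have supp k i : (mono (c k) 0 * e ^+ k) i != 0 ->
    exists n : nat, i = - ((n + k)%:R / b%:~R).
  rewrite coef_monoM subr0 mulf_eq0 negb_or => /andP[_]; exact: small_pow.
split.
  exists 0, b; split=> // k i /supp[n ->].
  by exists (n + k)%N; rewrite add0r.
move=> i; apply: sub_finite_set (finite_II (Num.bound `|i * b%:~R|).+1).
move=> k /= /supp[n ni]; rewrite ltnS ltnW // -(ltr_nat rat).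
apply: le_lt_trans (archi_boundP (normr_ge0 _)).
by rewrite ni mulNr normrN mulfVK ?gt_eqF // ger0_norm ?ler0n // ler_nat leq_addl.
Qed.

Let ex_inv f : f != 0 -> exists g, g * f = 1.
Proof.
move=> f0; have [d [fd fmax]] := ex_is_deg f0.
pose h := mono (f d)^-1 (- d) * f; pose e := 1 - h.
have hE i : h i = (f d)^-1 * f (i + d) by rewrite coef_monoM opprK.
have e0 i : 0 <= i -> e i = 0.
  rewrite le_eqVlt coefB coef1 hE => /orP[/eqP <-|i0].
    by rewrite eqxx add0r mulVf // subrr.
  by rewrite gt_eqF // (fmax (i + d)) ?ltrDr // mulr0 subrr.
suff [S SP] : exists S, S * (1 - e) = 1.
  by exists (S * mono (f d)^-1 (- d)); rewrite -mulrA -/h -SP /e subKr.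
pose E (k : nat) := mono 1 0 * e ^+ k.
have sE : summable E := summable_pow (fun=> 1) e0.
have EE k : E k = e ^+ k by rewrite /E mul1r.
exists (psum E); rewrite mulrC; apply/puiseuxP => j.
have [b b0 se] := neg_small e0.
have b0' : 0 < (b%:~R : rat) by rewrite ltr0z.
pose N := Num.bound `|j * b%:~R|.
have eN k i : (N <= k)%N -> j <= i -> (e ^+ k) i = 0.
  move=> Nk ji; have [//|ei] := eqVneq ((e ^+ k) i) 0.
  have [n ni] := small_pow se ei; move: ji; rewrite ni lerNr ler_pdivrMr //.
  rewrite leNgt mulNr => /negP; case.
  rewrite -mulNr; apply: le_lt_trans (ler_norm _) _; rewrite mulNr normrN.
  apply: lt_le_trans (archi_boundP (normr_ge0 _)) _.
  by rewrite ler_nat (leq_trans Nk) // leq_addl.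
have SE i : j <= i -> psum E i = (\sum_(k < N) e ^+ k) i.
  move=> ji; rewrite psumE // coef_sum (fsbig_ord _ _ (fun k => (e ^+ k) i)).
  rewrite -(fsbig_widen `I_N setT (fun k => E k i)) //; last first.
    by move=> k [_ /= /negP]; rewrite -leqNgt => Nk; rewrite /preimage /= EE eN.
  by apply: eq_fsbigr => k _; rewrite /= EE.
transitivity (((1 - e) * \sum_(k < N) e ^+ k) j).
  rewrite !coefM; apply: eq_fsbigr => i _.
  have [i0|i0] := leP i 0; first by rewrite SE // lerBrDr gerDl.
  by rewrite coefB coef1 gt_eqF // (e0 _ (ltW i0)) subr0 !mul0r.
by rewrite -opprB mulNr -subrX1 opprB coefB (eN N) // subr0.
Qed.

Definition invP f : puiseux K := xget 0 [set g | g * f = 1].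

Lemma mulVP f : f != 0 -> invP f * f = 1.
Proof.
by move=> /ex_inv [g gf]; rewrite /invP; case: xgetP => [h _ //|/(_ g)].
Qed.

Lemma invP0 : invP 0 = 0.
Proof.
rewrite /invP; case: xgetP => // h _ /=; rewrite mulr0 => /eqP.
by rewrite eq_sym oner_eq0.
Qed.

HB.instance Definition _ := GRing.ComNzRing_isField.Build (puiseux K) mulVP invP0.

End Field.

Section Calculus.
Variable K : fieldType.
Implicit Types (f e u : puiseux K) (a : rat).

Lemma mono0 d : mono 0 d = 0 :> puiseux K.
Proof. by apply/puiseuxP => i; rewrite monoE; case: ifP. Qed.

Lemma ratr_mono (q : rat) : ratr q = mono (ratr q) 0 :> puiseux K.
Proof.
have natM n : n%:R = mono n%:R 0 :> puiseux K.
  by apply/puiseuxP => i; rewrite -[n%:R in LHS]mul1r -[1]/(mono 1 0)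
    mulr_natr monoE; elim: n => [|n IHn]; rewrite ?mulr0n ?mulrS ?coefD ?coef0
    ?IHn ?monoE; case: ifP => //; rewrite addr0.
have intM (z : int) : z%:~R = mono z%:~R 0 :> puiseux K.
  case: z => n; first exact: natM.
  rewrite NegzE !rmorphN /= [LHS](congr1 -%R (natM n.+1)).
  by apply/puiseuxP => i; rewrite coefN !monoE; case: ifP; rewrite ?oppr0.
rewrite /ratr !intM; have [->|d0] := eqVneq ((denq q)%:~R : K) 0.
  by rewrite mono0 !invr0 !mulr0 mono0.
suff -> : (mono (denq q)%:~R 0)^-1 = mono (denq q)%:~R^-1 0 :> puiseux K.
  by rewrite monoM addr0.
have dV : mono (denq q)%:~R 0 * mono (denq q)%:~R^-1 0 = 1 :> puiseux K.
  by rewrite monoM addr0 divff.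
apply: (mulfI _ (etrans _ (esym dV))); last rewrite divff //.
  by apply: contra_eq_neq dV => ->; rewrite mul0r eq_sym oner_eq0.
by apply: contra_eq_neq dV => ->; rewrite mul0r eq_sym oner_eq0.
Qed.

Definition pderiv f : puiseux K := Pser (fun i => ratr (i + 1) * f (i + 1)).

Lemma pderivE f i : pderiv f i = ratr (i + 1) * f (i + 1).
Proof.
apply: PserE; have [a [b [b0 fab]]] := ramifiedP f; exists (a - 1), b; split=> //.
move=> k; have [->|/fab[n kn] _] := eqVneq (f (k + 1)) 0.
  by rewrite mulr0 eqxx.
by exists n; rewrite -[k](addrK 1) kn intrB addrAC.
Qed.

Definition binq a (k : nat) : rat := (\prod_(l < k) (a - l%:R)) / k`!%:R.

(* (1 + e)^a, for e with negative exponents only *)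
Definition binexp a e : puiseux K :=
  psum (fun k : nat => mono (ratr (binq a k)) 0 * e ^+ k).

(* f^a, where cp c a is the chosen value of c^a for c in K. *)
Definition ppow (cp : K -> rat -> K) f a : puiseux K :=
  if f == 0 then (a == 0)%:R else
  mono (cp (plc f) a) (a * pdeg f)
    * binexp a (mono (plc f)^-1 (- pdeg f) * f - 1).

Definition int_exps f : Prop := forall i, f i != 0 -> i \is a Num.int.
Definition nat_exps f : Prop := forall i, f i != 0 -> i \is a Num.nat.

(* The degree, with deg 0 = -oo. *)
Definition edeg f : \bar rat := if f == 0 then -oo%E else (pdeg f)%:E.

End Calculus.

Notation serA R := (puiseux R[i]).
Notation serC R := (puiseux (puiseux R[i])).

Section Jacobi.
Variable R : realType.
Implicit Types (F G H : serC R) (c : R[i]) (pw : R[i] -> rat -> R[i]).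

(* B and A[y], as subsets of C *)
Definition inB F : Prop := int_exps F.
Definition inAy F : Prop := nat_exps F.

Definition cst c : serC R := mono (mono c 0) 0.

Definition dY F : serC R := pderiv F.
Definition dX F : serC R := Pser (fun j => pderiv (F j)).

Lemma dXE F j : dX F j = pderiv (F j).
Proof.
apply: (PserE (F := fun j => pderiv (F j))).
have [a [b [b0 Fab]]] := ramifiedP F; exists a, b; split=> // k.
have [->|/Fab//] := eqVneq (F k) 0.
by rewrite (_ : pderiv 0 = 0) ?eqxx //; apply/puiseuxP => i;
  rewrite pderivE coef0 mulr0.
Qed.

Definition bracket F G : serC R := dX F * dY G - dY F * dX G.

Definition tr F : R[i] := F (-1) (-1).

(* The fixed choice of the scalars c^a: additive in the exponent, so that     *)
(* x |-> c x^i for i rational is multiplicative, and trivial at c = 1.        *)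
Definition power_choice pw : Prop :=
  [/\ forall c, c != 0 -> pw c 1 = c,
      forall c a b, c != 0 -> pw c (a + b) = pw c a * pw c b
    & forall a, pw 1 a = 1].

Definition powA pw (f : serA R) (a : rat) : serA R := ppow pw f a.
Definition powC pw F (a : rat) : serC R := ppow (powA pw) F a.

(* f_i in F = sum_i f_i y^(m-i), m = deg_y F *)
Definition ycoef F (i : nat) : serA R := F (pdeg F - i%:R).

Definition prime_slope F (p : rat) : Prop :=
  (forall i : nat,
     (edeg (ycoef F i) <= edeg (ycoef F 0) + (p * i%:R)%:E)%E) /\
  (exists2 i : nat, (0 < i)%N &
     edeg (ycoef F i) = (edeg (ycoef F 0) + (p * i%:R)%:E)%E).

Definition prime_degree F : \bar rat :=
  if F == mono (plc F) (pdeg F) then -oo%E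
  else if `[< exists p, prime_slope F p >]
  then (xget 0 [set p | prime_slope F p])%:E else +oo%E.

Definition jacobi_pair F G : Prop :=
  [/\ inB F /\ inB G, F != 0 /\ G != 0, 0 < pdeg F,
      exists2 J : R[i], J != 0 & bracket F G = cst J
    & [/\ prime_degree F != +oo%E, prime_degree F != -oo%E
        & (prime_degree G <= prime_degree F)%E]].

Definition jacobian_element F : Prop :=
  inB F /\ exists2 G, inB G &
    exists2 J : R[i], J != 0 & bracket F G = cst J.

(* The leading term (in y, then in x) of F is a nonzero constant c. Then all   *)
(* the powers F^a are expansions in F - c with exponents in {0, 1, 2, ...},    *)
(* so the traces of H F^a do not detect the fractional or negative powers of   *)
(* F - c: for F = 1 + x^-1 (a Jacobian element, since [F, - x^2 y] = 1) and    *)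
(* H = x^-5 y^-1 these traces all vanish, but [K, F] = H has no solution.      *)
Definition const_leading F : Prop :=
  [/\ F != 0, pdeg F = 0 & pdeg (plc F) = 0].

(* f(u) = sum_i f_i u^i, and F(u, v) for F in A[y] *)
Definition evalA pw (f u : serA R) : serA R :=
  psum (fun i : rat => mono (f i) 0 * powA pw u i).
Definition evalC pw F (u v : serA R) : serA R :=
  \sum_(j \in [set: nat]) evalA pw (F j%:R) u * v ^+ j.

(* The substitution x := u is meaningful in f: the series f(u) converges      *)
(* formally; for u = 0 only nonnegative powers of x may occur in f.           *)
Definition substitutable pw (f u : serA R) : Prop :=
  summable (fun i : rat => mono (f i) 0 * powA pw u i) /\
  (u = 0 -> forall i, f i != 0 -> 0 <= i).

End Jacobi.

(* Main.v *)
(* A bracket is a divergence, so its trace vanishes, and [F^a, F] = 0 because  *)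
(* F D(F^a) = a F^a D F for D = d/dx and D = d/dy. With the Leibniz rule this  *)
(* gives (4) and the necessity of the trace conditions in (2) and (3).         *)
(* Conversely, H = [K, F] is solved one power of y at a time. Let f0 be the    *)
(* leading coefficient of F in y, m = deg_y F, and h y^k the leading term of   *)
(* H. If m <> 0, then h y^k is the leading term of [kappa F^((k+1-m)/m), F]    *)
(* with m kappa' = h f0^(-(k+1)/m), and kappa exists because the residue of    *)
(* the right-hand side is the trace of H F^(-(k+1)/m). If m = 0 and            *)
(* deg_x f0 <> 0, then [- h y^(k+1) / ((k+1) f0'), F] does it for k <> -1,     *)
(* while for k = -1 the traces of the H F^a, which are the residues of the     *)
(* h f0^a, force h = 0. Every nonconstant F is in one of the two cases after   *)
(* subtracting a suitable constant.                                            *)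
(* In (1) the form F dG - J x dy is closed and its dx-part has no residue in   *)
(* x, so it is dW for some W in A[y]. The substitution is a ring morphism that *)
(* obeys the chain rule, so F dG/dt - J u dv/dt = d/dt W(u, v) has no residue. *)

From mathcomp Require Import all_boot all_order all_algebra ring lra.
From mathcomp Require Import boolp classical_sets functions cardinality fsbigop.
From mathcomp Require Import reals complex.
Require Import Defs.
Set Implicit Arguments.
Unset Strict Implicit.
Unset Printing Implicit Defensive.
Import Order.TTheory GRing.Theory Num.Theory.
Local Open Scope ring_scope.

(** * Degree bounds and density of finite sums *)

(** Two tools carry the proof. The first is the degree filtration: a series of degree below every
    bound is zero ([dle_eq0]), so an additive map that controls degrees is determined by monomials
    ([density]). Leibniz rules, multiplicativity of substitutions and chain rules are checked on
    monomials in this way. The second is the logarithmic derivative: F D(F^a) = a F^a D F follows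
    from the binomial series ([binexp_deriv], [ppow_deriv]). It gives [F^a, F] = 0 and, by
    [logderiv_uniq], the laws of exponents.

    Hence [K, F] F^a = [K F^a, F] is a divergence and has trace zero ([tres_brk_ppow]). Conversely,
    subtracting [K, F] from H changes no trace of H F^a, and one of these traces is exactly the
    obstruction to removing the leading term of H by such a bracket ([solve_lead_pdeg],
    [solve_lead_pdeg0]). The degrees of the corrections K decrease, so the corrections can be summed
    ([solve_brk]). A constant leading term of F is moved away by passing to F - c, which has the
    same brackets ([good_lead_shift]). Jacobian elements are the case H = 1, and the adjoint trace
    formula comes from [H G, F] = [H, F] G - H.

    For the substitution, F dG - J x dy is closed and has a potential ([closed_form_exact]); by the
    chain rule ([subst2_pderiv]) its pullback is a derivative, which has no residue. The value u = 0
    is treated separately ([res_subst2_0]). *)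

Definition dle (K : zmodType) (f : puiseux K) (d : rat) : Prop :=
  forall i, d < i -> f i = 0.

Definition finsupp (K : zmodType) (f : puiseux K) : Prop :=
  finite_set [set i | f i != 0]%classic.

Section Degree.
Variable K : zmodType.
Implicit Types (f g : puiseux K) (d e : rat).

Lemma dleW f d e : dle f d -> d <= e -> dle f e.
Proof. by move=> fd de i /(le_lt_trans de)/fd. Qed.

Lemma dle0 d : dle (0 : puiseux K) d. Proof. by []. Qed.

Lemma dleD f g d : dle f d -> dle g d -> dle (f + g) d.
Proof. by move=> fd gd i di; rewrite coefD fd ?gd ?addr0. Qed.

Lemma dleN f d : dle f d -> dle (- f) d.
Proof. by move=> fd i di; rewrite coefN fd ?oppr0. Qed.

Lemma dleB f g d : dle f d -> dle g d -> dle (f - g) d.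
Proof. by move=> fd gd; apply: dleD => //; apply: dleN. Qed.

Lemma dle_mono (c : K) d : dle (mono c d) d.
Proof. by move=> i di; rewrite monoE gt_eqF. Qed.

Lemma dle_coef f d i : dle f d -> f i != 0 -> i <= d.
Proof. by move=> fd; rewrite leNgt; apply: contraNN => /fd ->. Qed.

Lemma dle_pdeg f : dle f (pdeg f).
Proof.
have [->|f0] := eqVneq f 0; first exact: dle0.
by case: (pdegP f0).
Qed.

Lemma plc_neq0 f : f != 0 -> plc f != 0.
Proof. by case/pdegP. Qed.

Lemma coef_neq0 f i : f i != 0 -> f != 0.
Proof. by apply: contra_neq => ->. Qed.

Lemma pdeg_eq f d : f d != 0 -> dle f d -> pdeg f = d.
Proof.
move=> fd fdle; have f0 := coef_neq0 fd; apply/eqP; rewrite eq_le.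
rewrite (dle_coef fdle) ?plc_neq0 //=.
exact: dle_coef (@dle_pdeg f) fd.
Qed.

Lemma dle_eq0 f (c s : rat) : 0 < s -> (forall n, dle f (c - s * n%:R)) -> f = 0.
Proof.
move=> s0 fn; apply/puiseuxP => i; rewrite coef0.
apply: (fn (Num.bound `|(c - i) / s|)).
rewrite ltrBlDr -ltrBlDl mulrC -ltr_pdivrMr //.
by apply: le_lt_trans (ler_norm _) (archi_boundP _).
Qed.

Lemma sum_mono_coef f (s : seq rat) k : uniq s ->
  (\sum_(i <- s) mono (f i) i) k = if k \in s then f k else 0.
Proof.
move=> us; rewrite coef_sum.
under eq_bigr do rewrite monoE.
case: ifPn => ks.
  rewrite (bigD1_seq k) //= eqxx big1 ?addr0 // => i /negPf.
  by rewrite eq_sym => ->.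
rewrite big_seq big1 // => i si; case: eqP => // ki.
by rewrite ki si in ks.
Qed.

Lemma finsupp_sum f : finsupp f -> exists s : seq rat, f = \sum_(i <- s) mono (f i) i.
Proof.
move=> /finite_seqP[s fs]; exists (undup s); apply/puiseuxP => k.
rewrite sum_mono_coef ?undup_uniq // mem_undup; case: ifPn => // ks.
have [//|fk] := eqVneq (f k) 0.
have : [set i | f i != 0]%classic k by exact: fk.
by rewrite fs /= (negPf ks).
Qed.

(** The exponents lie in a grid bounded above, so only finitely many exceed a given bound. *)
Lemma trunc f d : exists s : seq rat, dle (f - \sum_(i <- s) mono (f i) i) d.
Proof.
have [a [b [b0 fab]]] := ramifiedP f.
have b0' : 0 < (b%:~R : rat) by rewrite ltr0z.
pose gp n : rat := a%:~R - n%:R / b%:~R.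
pose N := Num.bound ((a%:~R - d) * b%:~R).
have gpI : injective gp.
  move=> n m /addrI/oppr_inj /(mulIf _) /eqP.
  by rewrite invr_eq0 gt_eqF // eqr_nat => /(_ isT)/eqP.
exists [seq gp n | n <- iota 0 N] => k dk.
rewrite coefB sum_mono_coef ?(map_inj_uniq gpI) ?iota_uniq //.
case: ifPn => [_|kN]; first by rewrite subrr.
rewrite subr0; apply/eqP; apply: contraNT kN => /fab[n kn].
apply/mapP; exists n => //; rewrite mem_iota add0n leq0n /=.
rewrite -(ltr_nat rat); apply: le_lt_trans (archi_boundP _); last first.
  by rewrite mulr_ge0 ?subr_ge0 ?ltW //; apply: lt_le_trans dk _;
     rewrite kn gerBl divr_ge0 ?ler0n // ltW.
by rewrite -ler_pdivrMr // lerBrDl -lerBrDr -kn ltW.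
Qed.

Lemma finsupp_mono (c : K) d : finsupp (mono c d).
Proof.
apply: sub_finite_set (finite_set1 d) => i /=; rewrite monoE.
by case: (eqVneq i d) => // _; rewrite eqxx.
Qed.

Lemma finsupp0 : finsupp (0 : puiseux K).
Proof. by apply: sub_finite_set (finite_set0 rat) => i; rewrite /mkset coef0 eqxx. Qed.

Lemma finsuppD f g : finsupp f -> finsupp g -> finsupp (f + g).
Proof.
move=> ff fg; have := finite_setU [set i | f i != 0]%classic [set i | g i != 0]%classic.
move=> UE; have {UE}: finite_set ([set i | f i != 0] `|` [set i | g i != 0])%classic.
  by rewrite UE.
apply: sub_finite_set => i; rewrite /setU /mkset coefD.
have [->|] := eqVneq (f i) 0; last by left.
by rewrite add0r; right.
Qed.

Lemma finsuppN f : finsupp f -> finsupp (- f).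
Proof. by apply: sub_finite_set => i; rewrite /mkset coefN oppr_eq0. Qed.

Lemma finsupp_sumr (I : Type) (s : seq I) (E : I -> puiseux K) :
  (forall i, finsupp (E i)) -> finsupp (\sum_(i <- s) E i).
Proof. by move=> fE; elim/big_ind: _ => //; [exact: finsupp0|exact: finsuppD]. Qed.

End Degree.

Section Density.
Variables K L : zmodType.
Implicit Types (f g : puiseux K) (d e : rat) (S : puiseux K -> Prop) (T : puiseux K -> puiseux L).

(** Continuity for the degree filtration: as the slope [s] is positive, bounds that tend to minus
    infinity are sent to bounds that do so. *)
Definition dcont S T : Prop := exists s C, 0 < s /\
  forall f d, S f -> dle f d -> dle (T f) (s * d + C).

Definition additive_on S T : Prop :=
  [/\ S 0, forall f, S f -> S (- f), forall f g, S f -> S g -> S (f + g)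
    & forall f g, S f -> S g -> T (f + g) = T f + T g].

(* An additive map that kills monomials vanishes on finite sums and, by        *)
(* continuity, on all series.                                                  *)
Lemma density S T : additive_on S T ->
  (forall f d, S f -> S (mono (f d) d) /\ T (mono (f d) d) = 0) ->
  (forall f, S f -> finsupp f) \/ dcont S T ->
  forall f, S f -> T f = 0.
Proof.
move=> [S0 SN SD TD] Tm H f Sf.
have T0 : T 0 = 0 by apply: (addrI (T 0)); rewrite -TD // !addr0.
have Ts (s : seq rat) : S (\sum_(i <- s) mono (f i) i) /\ T (\sum_(i <- s) mono (f i) i) = 0.
  elim: s => [|i s [IH1 IH2]]; first by rewrite big_nil.
  by rewrite big_cons; have [Sm T0m] := Tm f i Sf; rewrite TD // T0m IH2 addr0; split; auto.
case: H => [/(_ f Sf)/finsupp_sum [s ->]|[s [C [s0 Tc]]]]; first by case: (Ts s).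
apply: (dle_eq0 (c := C) s0) => n.
have [r fr] := trunc f (- n%:R); have [S1 T1] := Ts r.
have S2 : S (f - \sum_(i <- r) mono (f i) i) by apply: SD => //; apply: SN.
rewrite -[f](subrK (\sum_(i <- r) mono (f i) i)) TD // T1 addr0.
by rewrite [C - _]addrC -mulrN; exact: Tc.
Qed.

Lemma density_all T s C : 0 < s -> {morph T : f g / f + g} ->
  (forall c d, T (mono c d) = 0) ->
  (forall f d, dle f d -> dle (T f) (s * d + C)) -> forall f, T f = 0.
Proof.
move=> s0 TD Tm Tc f; apply: (@density (fun=> True) T) => //.
by right; exists s, C; split=> // g d _; exact: Tc.
Qed.

End Density.

Section DegreeM.
Variable K : comNzRingType.
Implicit Types (f g : puiseux K) (d e : rat).

Lemma coefM_neq0 f g k : (f * g) k != 0 ->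
  exists i, f i != 0 /\ g (k - i) != 0.
Proof.
rewrite coefM => /(@fsbigN1 _ _ _ _ _ _ (fun k i => f i * g (k - i)))[i _ fg].
by exists i; split; apply: contra_neq fg => ->; rewrite ?mul0r ?mulr0.
Qed.

Lemma dleM f g d e : dle f d -> dle g e -> dle (f * g) (d + e).
Proof.
move=> fd ge k dek; apply/eqP; apply: contraTT dek => /coefM_neq0[i [fi gi]].
by rewrite -leNgt -[k](subrK i) addrC lerD // ?(dle_coef fd) ?(dle_coef ge).
Qed.

Lemma dleM_lead f g d e : dle f d -> dle g e -> (f * g) (d + e) = f d * g e.
Proof.
move=> fd ge; rewrite coefM -(fsbig_widen [set d]%classic) //; last first.
  move=> i [_ /= /eqP id]; have [di|] := ltP d i; first by rewrite fd ?mul0r.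
  rewrite le_eqVlt (negPf id) /= => di.
  by rewrite ge ?mulr0 //; lra.
by rewrite fsbig_set1 addrC addKr.
Qed.

Lemma dleX f n d : dle f d -> dle (f ^+ n) (d * n%:R).
Proof.
move=> fd; elim: n => [|n IHn]; first by rewrite mulr0; apply: dle_mono.
by rewrite exprS -natr1 mulrDr mulr1 addrC; exact: dleM.
Qed.

Lemma finsuppM f g : finsupp f -> finsupp g -> finsupp (f * g).
Proof.
move=> /finsupp_sum[s ->] /finsupp_sum[r ->].
rewrite mulr_suml; apply: finsupp_sumr => i; rewrite mulr_sumr.
by apply: finsupp_sumr => j; rewrite monoM; exact: finsupp_mono.
Qed.

Lemma int_expsM f g : (forall i, f i != 0 -> i \is a Num.int) ->
  (forall i, g i != 0 -> i \is a Num.int) -> forall i, (f * g) i != 0 -> i \is a Num.int.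
Proof.
move=> fi gi k /coefM_neq0[i [/fi ii /gi gii]].
by rewrite -[k](subrK i) rpredD.
Qed.

End DegreeM.

(** * Derivations and rational powers *)

(** Characteristic zero, expressed through the embedding of the rationals so that it passes from [K]
    to [puiseux K] and on to series of series. *)
Definition ratr_morph (K : fieldType) : Prop :=
  {morph (@ratr K) : x y / x + y} /\ {morph (@ratr K) : x y / x * y}.

Lemma monoD (K : zmodType) (c c' : K) d : mono (c + c') d = mono c d + mono c' d.
Proof.
by apply/puiseuxP => i; rewrite coefD !monoE; case: ifP; rewrite ?addr0.
Qed.

Lemma monoN (K : zmodType) (c : K) d : mono (- c) d = - mono c d.
Proof. by apply/puiseuxP => i; rewrite coefN !monoE; case: ifP; rewrite ?oppr0. Qed.

Lemma mono_z0 (K : zmodType) d : mono (0 : K) d = 0.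
Proof. by apply/puiseuxP => i; rewrite monoE if_same. Qed.

Lemma ratr_morph_num (K : numFieldType) : ratr_morph K.
Proof. by split=> x y; rewrite ?rmorphD ?rmorphM. Qed.

Section Ratr.
Variable K : fieldType.
Hypothesis hK : ratr_morph K.
Implicit Types x y : rat.

Lemma ratr_morph_puiseux : ratr_morph (puiseux K).
Proof.
have [hD hM] := hK; split=> x y; rewrite !ratr_mono; first by rewrite hD monoD.
by rewrite monoM hM addr0.
Qed.

Lemma ratrm1 : ratr 1 = 1 :> K. Proof. by rewrite -[1]/(1%:R) ratr_nat. Qed.
Lemma ratrm0 : ratr 0 = 0 :> K. Proof. by rewrite -[0]/(0%:R) ratr_nat. Qed.

Lemma ratrmN x : ratr (- x) = - ratr x :> K.
Proof. by apply: (addrI (ratr x)); rewrite -hK.1 !subrr ratrm0. Qed.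

Lemma ratrm_eq0 x : (ratr x == 0 :> K) = (x == 0).
Proof.
have [->|x0] := eqVneq x 0; first by rewrite ratrm0 eqxx.
apply/eqP => rx; have : ratr (x * x^-1) = 1 :> K by rewrite mulfV ?ratrm1.
by rewrite hK.2 rx mul0r => /esym/eqP; rewrite oner_eq0.
Qed.

End Ratr.

Section Derivation.
Variable K : fieldType.
Hypothesis hK : ratr_morph K.
Implicit Types (f g e : puiseux K) (a d : rat) (D : puiseux K -> puiseux K).

Definition shifts D (s : rat) := forall f d, dle f d -> dle (D f) (d + s).

Definition is_derivation D : Prop :=
  [/\ {morph D : f g / f + g},
      forall f g, D (f * g) = D f * g + f * D g,
      exists s, shifts D s
    & forall q : rat, D (ratr q) = 0].

(** The defect of the Leibniz rule is additive in each factor and shifts degrees by at most s.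
    Density is applied to the first factor, with the second a monomial, and then to the second. *)
Lemma leibniz_of_mono D s : {morph D : f g / f + g} -> shifts D s ->
  (forall c d c' d', D (mono c d * mono c' d')
     = D (mono c d) * mono c' d' + mono c d * D (mono c' d')) ->
  forall f g, D (f * g) = D f * g + f * D g.
Proof.
move=> DD Ds Dm.
pose T f g := D (f * g) - (D f * g + f * D g).
have bound f g d d' : dle f d -> dle g d' -> dle (T f g) (d + d' + s).
  move=> fd gd; apply: dleB; first exact/Ds/dleM.
  apply: dleD; last by rewrite -addrA; apply: dleM => //; apply: Ds.
  by rewrite addrAC; apply: dleM => //; apply: Ds.
have Tm c' d' f : T f (mono c' d') = 0.
  apply: (@density_all _ _ (T^~ (mono c' d')) 1 (d' + s)) => //.
  - by move=> g h; rewrite /T mulrDl !DD; ring.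
  - by move=> c d; rewrite /T Dm subrr.
  by move=> g d gd; rewrite mul1r addrA; apply: bound => //; exact: dle_mono.
move=> f g; apply/eqP; rewrite -subr_eq0; apply/eqP.
apply: (@density_all _ _ (T f) 1 (pdeg f + s)) => //.
- by move=> g' h; rewrite /T mulrDr !DD; ring.
move=> h d hd.
by rewrite mul1r addrA [d + _]addrC; apply: bound => //; exact: dle_pdeg.
Qed.

Lemma pderivD : {morph @pderiv K : f g / f + g}.
Proof.
by move=> f g; apply/puiseuxP => i; rewrite coefD !pderivE coefD mulrDr.
Qed.

Lemma pderiv_mono (c : K) d : pderiv (mono c d) = mono (ratr d * c) (d - 1).
Proof.
apply/puiseuxP => i; rewrite pderivE !monoE eq_sym -subr_eq eq_sym.
by case: eqP => [->|_]; rewrite ?mulr0 // subrK.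
Qed.

Lemma shifts_pderiv : shifts (@pderiv K) (- 1).
Proof. by move=> f d fd i di; rewrite pderivE fd ?mulr0 //; lra. Qed.

Lemma pderivM f g : pderiv (f * g) = pderiv f * g + f * pderiv g.
Proof.
apply: leibniz_of_mono pderivD shifts_pderiv _ f g => c d c' d'.
rewrite !(monoM, pderiv_mono) hK.1.
have -> : d - 1 + d' = d + d' - 1 by lra.
have -> : d + (d' - 1) = d + d' - 1 by lra.
by rewrite -monoD; congr mono; ring.
Qed.

Lemma pderiv_ratr (q : rat) : pderiv (ratr q : puiseux K) = 0.
Proof. by rewrite ratr_mono pderiv_mono ratrm0 mul0r mono_z0. Qed.

Lemma pderiv_derivation : is_derivation (@pderiv K).
Proof.
split; [exact: pderivD|exact: pderivM|by exists (-1); exact: shifts_pderiv|].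
exact: pderiv_ratr.
Qed.

Lemma pderiv_eq0 f : pderiv f = 0 -> f = mono (f 0) 0.
Proof.
move=> /puiseuxP f0; apply/puiseuxP => i; rewrite monoE; case: eqP => [->//|/eqP i0].
have /eqP := f0 (i - 1); rewrite pderivE subrK coef0 mulf_eq0 ratrm_eq0 // (negPf i0).
by move/eqP.
Qed.

Lemma pderiv_residue f : pderiv f (-1) = 0.
Proof. by rewrite pderivE addrC subrr ratrm0 mul0r. Qed.

Section Additive.
Variable D : puiseux K -> puiseux K.
Hypothesis dD : is_derivation D.

Lemma deriv_0 : D 0 = 0.
Proof. by have [DD _ _ _] := dD; apply: (addrI (D 0)); rewrite -DD !addr0. Qed.

Lemma deriv_N f : D (- f) = - D f.
Proof. by have [DD _ _ _] := dD; apply: (addrI (D f)); rewrite -DD !subrr deriv_0. Qed.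

Lemma deriv_B f g : D (f - g) = D f - D g.
Proof. by have [DD _ _ _] := dD; rewrite DD deriv_N. Qed.

Lemma deriv_1 : D 1 = 0.
Proof. by have [_ _ _ Dr] := dD; rewrite -(Dr 1) ratrm1. Qed.

Lemma deriv_X f n : D (f ^+ n) = n%:R * f ^+ n.-1 * D f.
Proof.
have [_ DM _ _] := dD.
elim: n => [|n IHn]; first by rewrite mul0r mul0r deriv_1.
rewrite exprS DM IHn /=; case: n {IHn} => [|n]; first by rewrite /=; ring.
by rewrite /= -[n.+2%:R]natr1 [f ^+ n.+1]exprS; ring.
Qed.

End Additive.

Lemma deriv_V D : is_derivation D -> forall f, f != 0 -> D f^-1 = - D f / f ^+ 2.
Proof.
move=> dD f f0; have [_ DM _ _] := dD.
have /eqP := DM f f^-1; rewrite mulfV // (deriv_1 dD) eq_sym addr_eq0 => /eqP E.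
have -> : D f = - (f * D f^-1) * f by rewrite -E mulfVK.
by field.
Qed.

(** A nonzero series attains its degree, so negative exponents stay away from 0 by a fixed gap; the
    powers of [e] then tend to zero. *)
Lemma negdeg e : (forall i, 0 <= i -> e i = 0) -> exists2 s, 0 < s & dle e (- s).
Proof.
move=> e0; have [->|en] := eqVneq e 0; first by exists 1.
exists (- pdeg e); last by rewrite opprK; exact: dle_pdeg.
by rewrite oppr_gt0 ltNge; apply: contra_neqN (plc_neq0 en) => /e0.
Qed.

Definition binpart a e N : puiseux K := \sum_(k < N) ratr (binq a k) * e ^+ k.

Lemma binexp_part a e s N : 0 < s -> dle e (- s) ->
  dle (binexp a e - binpart a e N) (- s * N%:R).
Proof.
move=> s0 es i iN; apply/eqP; rewrite coefB subr_eq0; apply/eqP.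
have e0 j : 0 <= j -> e j = 0 by move=> j0; apply: es; lra.
rewrite psumE; last exact: summable_pow.
rewrite /binpart coef_sum (fsbig_ord _ _ (fun k => (ratr (binq a k) * e ^+ k) i)).
rewrite -(fsbig_widen `I_N%classic setT) //.
  by apply: eq_fsbigr => k _; rewrite ratr_mono.
move=> k [_ /= /negP]; rewrite -leqNgt => Nk; rewrite /preimage /= coef_monoM.
rewrite (dleX (n := k) es) ?mulr0 // subr0; apply: le_lt_trans iN.
by rewrite !mulNr lerN2 ler_pM2l // ler_nat.
Qed.

Lemma binexp_lead a e : (forall i, 0 <= i -> e i = 0) ->
  dle (binexp a e) 0 /\ binexp a e 0 = 1.
Proof.
move=> /negdeg[s s0 es]; have := binexp_part (N := 1) a s0 es.
rewrite /binpart big_ord_recl big_ord0 addr0 expr0 mulr1 mulr1 => h.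
have b0 : binq a 0 = 1 by rewrite /binq big_ord0 fact0 divr1.
split=> [i i0|].
  have := h i; rewrite coefB ratr_mono b0 monoE (gt_eqF i0) subr0; apply.
  by apply: lt_trans i0; rewrite oppr_lt0.
have := h 0; rewrite coefB ratr_mono b0 monoE eqxx ratrm1 oppr_lt0.
by move=> /(_ s0)/eqP; rewrite subr_eq0 => /eqP.
Qed.

Lemma binqS a k : k.+1%:R * binq a k.+1 = (a - k%:R) * binq a k.
Proof.
rewrite /binq big_ord_recr /= factS natrM; field.
by rewrite nat1r !pnatr_eq0 -lt0n fact_gt0.
Qed.

(** The truncated binomial series satisfies the differential equation of (1 + e)^a up to one
    boundary term, since the others telescope by [binqS]. At N = 0 the factor N makes the truncated
    exponent [N.-1] harmless. *)
Lemma binpart_deriv D a e N : is_derivation D ->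
  (1 + e) * D (binpart a e N) - ratr a * binpart a e N * D e
    = - (ratr (N%:R * binq a N) * e ^+ N.-1 * D e).
Proof.
move=> dD; have [DD DM _ Dr] := dD; have [rD rM] := ratr_morph_puiseux hK.
elim: N => [|N IHN].
  rewrite /binpart !big_ord0 (deriv_0 dD) mul0r ratrm0; ring.
have -> : binpart a e N.+1 = binpart a e N + ratr (binq a N) * e ^+ N.
  by rewrite /binpart big_ord_recr.
rewrite DD DM Dr (deriv_X dD) binqS; move: (binq a N) IHN => b IHN.
rewrite !rM rD (ratrmN (ratr_morph_puiseux hK)) ratr_nat.
rewrite /= mul0r add0r.
move/eqP: IHN; rewrite subr_eq => /eqP IHN; rewrite mulrDr {}IHN rM ratr_nat.
case: N => [|N] /=; first by rewrite expr0; ring.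
by rewrite exprS; ring.
Qed.

(** Limit of [binpart_deriv]: the tail and the boundary term have degrees tending to minus
    infinity. *)
Lemma binexp_deriv D a e : is_derivation D -> (forall i, 0 <= i -> e i = 0) ->
  (1 + e) * D (binexp a e) = ratr a * binexp a e * D e.
Proof.
move=> dD /negdeg[s s0 es]; have [DD _ [t Dt] _] := dD.
apply/eqP; rewrite -subr_eq0; apply/eqP; apply: (dle_eq0 (c := t) s0) => n.
set B := binexp a e; set Bn := binpart a e n.
have BE : B = (B - Bn) + Bn by rewrite subrK.
have Bd : dle (B - Bn) (- s * n%:R) := @binexp_part a e s n s0 es.
have -> : (1 + e) * D B - ratr a * B * D e =
   (1 + e) * D (B - Bn) - ratr a * ((B - Bn) * D e)
     + ((1 + e) * D Bn - ratr a * Bn * D e).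
  by rewrite {1}BE DD; ring.
have d1 : dle (1 + e) 0.
  apply: dleD; first exact: dle_mono.
  by apply: dleW es _; rewrite oppr_le0 ltW.
have dr q : dle (ratr q : puiseux K) 0 by rewrite ratr_mono; exact: dle_mono.
apply: dleD; first apply: dleB.
- by apply: dleW (dleM d1 (Dt _ _ Bd)) _; lra.
- by apply: dleW (dleM (dr _) (dleM Bd (Dt _ _ es))) _; lra.
rewrite binpart_deriv //; apply: dleN.
case: n {Bn BE Bd} => [|n]; first by rewrite mul0r ratrm0 !mul0r.
apply: dleW (dleM (dleM (dr _) (dleX (n := n) es)) (Dt _ _ es)) _.
rewrite -natr1; lra.
Qed.

Section Ppow.
Variable cp : K -> rat -> K.
Variable f : puiseux K.
Hypothesis f0 : f != 0.

Let e := mono (plc f)^-1 (- pdeg f) * f - 1.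

Let e_neg i : 0 <= i -> e i = 0.
Proof.
have c0 := plc_neq0 f0.
rewrite le_eqVlt coefB coef1 coef_monoM opprK => /orP[/eqP <-|i0].
  by rewrite eqxx add0r mulVf // subrr.
by rewrite gt_eqF // (@dle_pdeg _ f (i + _)) ?ltrDr // mulr0 subrr.
Qed.

Let fE : f = mono (plc f) (pdeg f) * (1 + e).
Proof. by rewrite /e addrC subrK mulrA monoM mulfV ?plc_neq0 // subrr mul1r. Qed.

Let ppowE a : ppow cp f a = mono (cp (plc f) a) (a * pdeg f) * binexp a e.
Proof. by rewrite /ppow (negPf f0). Qed.

Lemma dle_ppow a : dle (ppow cp f a) (a * pdeg f).
Proof.
have [h _] := binexp_lead a e_neg; rewrite ppowE.
by have := dleM (@dle_mono _ (cp (plc f) a) (a * pdeg f)) h; rewrite addr0.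
Qed.

Lemma ppow_lead a : ppow cp f a (a * pdeg f) = cp (plc f) a.
Proof.
by rewrite ppowE coef_monoM subrr; case: (binexp_lead a e_neg) => _ ->; rewrite mulr1.
Qed.

(** f^a is a monomial times (1 + e)^a, and logarithmic derivatives add, so the rule has to be known
    only for the leading monomial. For d/dx on series in y the leading coefficient is itself
    differentiated. *)
Lemma ppow_deriv D a : is_derivation D ->
  mono (plc f) (pdeg f) * D (mono (cp (plc f) a) (a * pdeg f))
    = ratr a * mono (cp (plc f) a) (a * pdeg f) * D (mono (plc f) (pdeg f)) ->
  f * D (ppow cp f a) = ratr a * ppow cp f a * D f.
Proof.
move=> dD; have [_ DM _ _] := dD; rewrite ppowE.
set p := mono (plc f) _; set q := mono (cp _ _) _ => pq.
have De : D (1 + e) = D e by have [DD _ _ _] := dD; rewrite DD (deriv_1 dD) add0r.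
have Be := binexp_deriv a dD e_neg.
rewrite fE -/p !DM De; set B := binexp a e in Be *.
have -> : p * (1 + e) * (D q * B + q * D B) =
  (p * D q) * (1 + e) * B + p * q * ((1 + e) * D B) by ring.
by rewrite pq Be; ring.
Qed.

Lemma ppow_pderiv a : f * pderiv (ppow cp f a) = ratr a * ppow cp f a * pderiv f.
Proof.
apply: ppow_deriv; first exact: pderiv_derivation.
rewrite !pderiv_mono ratr_mono !monoM hK.2; congr mono; first by ring.
by lra.
Qed.

Lemma ppow_exps (b a i : rat) : (forall j, f j != 0 -> b * j \is a Num.int) ->
  ppow cp f a i != 0 -> b * (i - a * pdeg f) \is a Num.int.
Proof.
move=> fi; rewrite ppowE coef_monoM mulf_eq0 negb_or => /andP[_].
have d_int : b * pdeg f \is a Num.int by apply: fi; exact: plc_neq0.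
have e_int j : e j != 0 -> b * j \is a Num.int.
  rewrite coefB coef1 coef_monoM; case: (j =P 0) => [->|_]; first by rewrite mulr0.
  rewrite subr0 mulf_eq0 negb_or => /andP[_ /fi jd].
  by rewrite -[b * j](subrK (- (b * pdeg f))) rpredD ?rpredN // -mulrN -mulrBr.
have eX k j : (e ^+ k) j != 0 -> b * j \is a Num.int.
  elim: k j => [|k IHk] j.
    rewrite expr0 coef1; case: (j =P 0) => [->|]; first by rewrite mulr0.
    by rewrite eqxx.
  rewrite exprS => /coefM_neq0[l [/e_int li /IHk ji]].
  by rewrite -[j](subrK l) mulrDr rpredD.
rewrite psumE; last exact: summable_pow.
case/(@fsbigN1 _ _ _ _ _ _ (fun i k => (mono (ratr (binq a k)) 0 * e ^+ k) i)) => k _.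
by rewrite coef_monoM subr0 mulf_eq0 negb_or => /andP[_ /eX].
Qed.

Lemma ppow_int_exps a i : int_exps f -> ppow cp f a i != 0 -> i - a * pdeg f \is a Num.int.
Proof.
move=> fi Pi; rewrite -[_ - _]mul1r; apply: ppow_exps Pi => j fj.
by rewrite mul1r; exact: fi.
Qed.

End Ppow.

End Derivation.

(* [power_choice] over an arbitrary field. *)
Definition scalar_powers (K : fieldType) (cp : K -> rat -> K) : Prop :=
  [/\ forall c, c != 0 -> cp c 1 = c,
      forall c a b, c != 0 -> cp c (a + b) = cp c a * cp c b
    & forall a, cp 1 a = 1].

(** * Laws of exponents and antiderivatives *)

Section Powers.
Variable K : fieldType.
Hypothesis hK : ratr_morph K.
Implicit Types (f g : puiseux K).

(* Both g1 and g2 behave like f^a up to a constant factor. *)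
Lemma logderiv_uniq f g1 g2 a t : f != 0 ->
  f * pderiv g1 = ratr a * g1 * pderiv f ->
  f * pderiv g2 = ratr a * g2 * pderiv f ->
  dle g1 t -> dle g2 t -> g1 t = g2 t -> g2 t != 0 -> g1 = g2.
Proof.
move=> f0 e1 e2 d1 d2 e12 g2t; have g20 := coef_neq0 g2t.
have dV := deriv_V (pderiv_derivation hK) g20.
(* The quotient has derivative zero, so it is a constant; comparing coefficients at [t] shows that
   it is 1. *)
have h0 : pderiv (g1 / g2) = 0.
  apply: (mulfI f0); rewrite mulr0 pderivM // dV.
  have -> : f * (pderiv g1 / g2 + g1 * (- pderiv g2 / g2 ^+ 2)) =
     (f * pderiv g1) / g2 - g1 * (f * pderiv g2) / g2 ^+ 2 by ring.
  by rewrite e1 e2; field.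
have g1E : g1 = mono ((g1 / g2) 0) 0 * g2.
  by rewrite -(pderiv_eq0 hK h0) divfK.
have c1 : (g1 / g2) 0 = 1.
  have := congr1 (fun h : puiseux K => h t) g1E; rewrite /= coef_monoM subr0 e12 => E.
  by apply: (mulIf g2t); rewrite mul1r -E.
by rewrite g1E c1 mul1r.
Qed.

(** At exponent 0 the convention 0^-1 = 0 discards the residue of [f] and makes the integration
    constant zero. *)
Definition integ f : puiseux K := Pser (fun i => ratr i^-1 * f (i - 1)).

Lemma integE f i : integ f i = ratr i^-1 * f (i - 1).
Proof.
apply: (PserE (F := fun i => ratr i^-1 * f (i - 1))).
have [a [b [b0 fab]]] := ramifiedP f; exists (a + 1), b; split=> // k.
have [->|/fab[n kn] _] := eqVneq (f (k - 1)) 0; first by rewrite mulr0 eqxx.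
by exists n; rewrite -[k](subrK 1) kn intrD addrAC.
Qed.

Lemma pderiv_integ f : f (-1) = 0 -> pderiv (integ f) = f.
Proof.
move=> f1; apply/puiseuxP => i; rewrite pderivE integE addrK mulrA -hK.2.
have [i1|i1] := eqVneq (i + 1) 0; last by rewrite mulfV // ratrm1 mul1r.
by move/eqP: i1; rewrite addr_eq0 => /eqP ->; rewrite f1 mulr0.
Qed.

Lemma antideriv f : f (-1) = 0 -> exists g, pderiv g = f.
Proof. by move=> f1; exists (integ f); exact: pderiv_integ. Qed.

Section PowerChoice.
Variable cp : K -> rat -> K.
Hypothesis hcp : scalar_powers cp.

Lemma scalar_power0 c : c != 0 -> cp c 0 = 1.
Proof.
have [p1 pD _] := hcp => c0; apply: (mulfI c0).
by rewrite -{1}(p1 c c0) -pD // addr0 mulr1 p1.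
Qed.

Lemma scalar_power_neq0 c a : c != 0 -> cp c a != 0.
Proof.
have [_ pD _] := hcp => c0; have : cp c a * cp c (- a) != 0.
  by rewrite -pD // subrr scalar_power0 // oner_neq0.
by rewrite mulf_eq0 negb_or => /andP[].
Qed.

Lemma ppow_lead_neq0 f a : f != 0 -> ppow cp f a (a * pdeg f) != 0.
Proof. by move=> f0; rewrite ppow_lead // scalar_power_neq0 // plc_neq0. Qed.

Lemma ppow1 f : f != 0 -> ppow cp f 1 = f.
Proof.
move=> f0; have [p1 _ _] := hcp.
have L := ppow_lead cp f0 1; rewrite p1 ?plc_neq0 // mul1r in L.
apply: (logderiv_uniq (a := 1) (t := pdeg f) f0) => //.
- exact: ppow_pderiv.
- by rewrite ratrm1 mul1r.
- by have := @dle_ppow _ cp f f0 1; rewrite mul1r.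
- exact: dle_pdeg.
- exact: plc_neq0.
Qed.

Lemma ppow0 f : f != 0 -> ppow cp f 0 = 1.
Proof.
move=> f0; have L := ppow_lead cp f0 0; rewrite scalar_power0 ?plc_neq0 // mul0r in L.
apply: (logderiv_uniq (a := 0) (t := 0) f0).
- exact: ppow_pderiv.
- by rewrite (deriv_1 (pderiv_derivation hK)) mulr0 ratrm0 !mul0r.
- by have := @dle_ppow _ cp f f0 0; rewrite mul0r.
- exact: dle_mono.
- by rewrite L coef1 eqxx.
- by rewrite coef1 eqxx oner_neq0.
Qed.

(** Both sides have logarithmic derivative (a + b) f'/f, and their leading coefficients agree by
    additivity of the scalar powers. *)
Lemma ppowD f a b : f != 0 -> ppow cp f a * ppow cp f b = ppow cp f (a + b).
Proof.
move=> f0; have [_ pD _] := hcp.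
have da := @dle_ppow _ cp f f0 a; have db := @dle_ppow _ cp f f0 b.
apply: (logderiv_uniq (a := a + b) (t := (a + b) * pdeg f) f0).
- have Ea := ppow_pderiv hK cp f0 a; have Eb := ppow_pderiv hK cp f0 b.
  rewrite (pderivM hK) (ratr_morph_puiseux hK).1.
  move: (ppow cp f a) (ppow cp f b) Ea Eb => x y Ea Eb.
  transitivity (f * pderiv x * y + x * (f * pderiv y)); first by ring.
  by rewrite Ea Eb; ring.
- exact: ppow_pderiv.
- by rewrite mulrDl; apply: dleM.
- exact: dle_ppow.
- have := dleM_lead da db; rewrite -[_ + _ in LHS]mulrDl => ->.
  apply: (etrans (congr2 *%R (ppow_lead cp f0 a) (ppow_lead cp f0 b))).
  apply: (etrans _ (esym (ppow_lead cp f0 (a + b)))).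
  by rewrite pD // plc_neq0.
- exact: ppow_lead_neq0.
Qed.

End PowerChoice.

End Powers.

(** * Series with integer exponents and their infinite sums *)

Section IntSeries.
Variable K : fieldType.

Lemma int_gap (x : rat) : x \is a Num.int -> -1 < x -> x < 0 -> False.
Proof.
move=> /Num.Theory.intrP[z ->]; rewrite -[-1]/((-1)%:~R) -[0]/(0%:~R) !ltr_int.
by rewrite -lez1D subrr => z0 /(le_lt_trans z0); rewrite ltxx.
Qed.

Lemma dle_int_pred (f : puiseux K) (k : rat) : int_exps f -> k \is a Num.int ->
  dle f k -> f k = 0 -> dle f (k - 1).
Proof.
move=> fi ki fk fk0 i ik; have [/fk//|ik'] := ltP k i.
move: ik'; rewrite le_eqVlt => /orP[/eqP ->//|ik'].
apply/eqP; apply: contraT => /fi ii; exfalso.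
by apply: (@int_gap (i - k)); rewrite ?rpredB //; lra.
Qed.

Lemma ramified_int (F : rat -> K) (c : rat) :
  (forall i, F i != 0 -> i \is a Num.int) -> (forall i, c < i -> F i = 0) ->
  ramified F.
Proof.
move=> Fi Fc; exists (Num.ceil c), 1; split=> // i Fi0.
have /Num.Theory.intrP[z iz] := Fi _ Fi0.
have ic : i <= c by rewrite leNgt; apply: contraNN Fi0 => /Fc ->.
have zc : z <= Num.ceil c.
  by rewrite -(ler_int rat) -iz; apply: le_trans ic (ceil_ge _).
exists `|(Num.ceil c - z)%R|%N.
rewrite natr_absz ger0_norm ?subr_ge0 // divr1 intrB iz; ring.
Qed.

(** The coefficient at [j] no longer changes from the partial sum of index [N j] on, since all later
    terms have degree below [j]. *)
Lemma int_series_sum (E : nat -> puiseux K) (c : rat) :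
  (forall n, int_exps (E n)) -> (forall n, dle (E n) (c - n%:R)) ->
  exists2 S, int_exps S & forall n, dle (S - \sum_(i < n) E i) (c - n%:R).
Proof.
move=> Ei Ed; pose S n := \sum_(i < n) E i.
have S_stable j n l : c - n%:R < j -> S (n + l)%N j = S n j.
  move=> nj; elim: l => [|l IHl]; first by rewrite addn0.
  have -> : S (n + l.+1)%N = S (n + l)%N + E (n + l)%N.
    by rewrite addnS /S big_ord_recr.
  rewrite coefD IHl Ed ?addr0 //.
  by apply: le_lt_trans nj; rewrite natrD lerB // lerDl ler0n.
pose N j := Num.bound `|c - j|.
have NP j : c - (N j)%:R < j.
  rewrite ltrBlDr -ltrBlDl; apply: le_lt_trans (ler_norm _) (archi_boundP _).
  exact: normr_ge0.
have SN j n : c - n%:R < j -> S (N j) j = S n j.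
  move=> nj; have [h|h] := leqP n (N j); first by rewrite -(subnKC h) S_stable.
  by rewrite -(subnKC (ltnW h)) S_stable.
have Si j n : S n j != 0 -> j \is a Num.int.
  rewrite /S coef_sum => Sj; apply: contraT => ji.
  rewrite big1 ?eqxx // in Sj => i _; apply/eqP; apply: contraNT ji; exact: Ei.
have ram : ramified (fun j => S (N j) j).
  apply: (@ramified_int _ c) => [j|j cj]; first exact: Si.
  by rewrite (SN _ 0) ?subr0 // /S big_ord0.
exists (Pser (fun j => S (N j) j)) => [j|n j nj]; rewrite ?coefB PserE //.
  exact: Si.
by rewrite (SN _ n) // subrr.
Qed.

End IntSeries.

(** * The bracket *)

(* L stands for A, with der = d/dx. It is kept abstract since unification      *)
(* unfolds the structures of the nested series of the statement very slowly.   *)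
Section Bracket.
Variable L : fieldType.
Hypothesis hL : ratr_morph L.
Variable der : L -> L.
Hypothesis dD : {morph der : f g / f + g}.
Hypothesis dM : forall f g, der (f * g) = der f * g + f * der g.
Hypothesis dr : forall q : rat, der (ratr q) = 0.
Implicit Types (F G H : puiseux L) (f g : L) (a b d e : rat).

Lemma der_0 : der 0 = 0.
Proof. by rewrite -[0 in LHS]ratrm0 dr. Qed.

Definition derX F : puiseux L := Pser (fun j => der (F j)).
Definition derY F : puiseux L := pderiv F.
Definition brk F G : puiseux L := derX F * derY G - derY F * derX G.

Lemma derXE F j : derX F j = der (F j).
Proof.
apply: (PserE (F := fun j => der (F j))).
have [a [b [b0 Fab]]] := ramifiedP F; exists a, b; split=> // k.
by have [->|/Fab//] := eqVneq (F k) 0; rewrite der_0 eqxx.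
Qed.

Lemma derXD : {morph derX : F G / F + G}.
Proof.
by move=> F G; apply/puiseuxP => i; rewrite coefD !derXE coefD dD.
Qed.

Lemma derX_mono f d : derX (mono f d) = mono (der f) d.
Proof.
apply/puiseuxP => i; rewrite derXE !monoE; case: ifP => // _.
exact: der_0.
Qed.

Lemma shifts_derX : shifts (derX) 0.
Proof.
move=> F d Fd i; rewrite addr0 derXE => /Fd ->.
exact: der_0.
Qed.

Lemma derX_derivation : is_derivation (derX).
Proof.
split; [exact: derXD| |by exists 0; exact: shifts_derX|]; last first.
  by move=> q; rewrite ratr_mono derX_mono dr mono_z0.
apply: leibniz_of_mono derXD shifts_derX _ => c d c' d'.
by rewrite monoM 3!derX_mono 2!monoM dM monoD.
Qed.

Lemma derY_derivation : is_derivation (derY).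
Proof. exact: pderiv_derivation. Qed.

Lemma derXM F G : derX (F * G) = derX F * G + F * derX G.
Proof. by case: derX_derivation. Qed.

Lemma derYM F G : derY (F * G) = derY F * G + F * derY G.
Proof. by case: derY_derivation. Qed.

Lemma derYD F G : derY (F + G) = derY F + derY G.
Proof. by case: derY_derivation => ->. Qed.

Lemma derY_mono f d : derY (mono f d) = mono (ratr d * f) (d - 1).
Proof. exact: pderiv_mono. Qed.

Lemma derXY F : derX (derY F) = derY (derX F).
Proof.
apply/puiseuxP => j.
have E1 : derY F j = ratr (j + 1) * F (j + 1) by exact: pderivE.
have E2 : derY (derX F) j = ratr (j + 1) * derX F (j + 1) by exact: pderivE.
apply: (etrans (derXE _ _)); apply: (etrans _ (esym E2)).
by rewrite E1 dM dr mul0r add0r derXE.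
Qed.

Lemma brkC F G : brk F G = - brk G F.
Proof. by rewrite /brk; ring. Qed.

Lemma brkDl F G H : brk (F + G) H = brk F H + brk G H.
Proof. by rewrite /brk derXD derYD; ring. Qed.

Lemma brkNl F H : brk (- F) H = - brk F H.
Proof.
by rewrite /brk (deriv_N derX_derivation) (deriv_N derY_derivation); ring.
Qed.

Lemma brkMl F G H : brk (F * G) H = brk F H * G + F * brk G H.
Proof. by rewrite /brk derXM derYM; ring. Qed.

Lemma brk_const (c : L) F : der c = 0 -> brk (mono c 0) F = 0.
Proof.
move=> c0; rewrite /brk derX_mono c0 derY_mono ratrm0 mul0r.
by rewrite !mono_z0 !mul0r subrr.
Qed.

(** On expansion the terms with mixed derivatives cancel by [derXY]. *)
Lemma brk_divergence F G : brk F G = derX (F * derY G) - derY (F * derX G).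
Proof. by rewrite /brk derXM derYM derXY; ring. Qed.

Lemma dle_brk F G d e : dle F d -> dle G e -> dle (brk F G) (d + e - 1).
Proof.
move=> Fd Ge; have dYF : dle (derY F) (d - 1) := shifts_pderiv Fd.
have dYG : dle (derY G) (e - 1) := shifts_pderiv Ge.
apply: dleB; first by apply: dleW (dleM (shifts_derX Fd) dYG) _; lra.
by apply: dleW (dleM dYF (shifts_derX Ge)) _; lra.
Qed.

Lemma int_expsD F G : int_exps F -> int_exps G -> int_exps (F + G).
Proof.
move=> Fi Gi i; rewrite coefD; have [->|/Fi//] := eqVneq (F i) 0.
by rewrite add0r => /Gi.
Qed.

Lemma int_expsN F : int_exps F -> int_exps (- F).
Proof. by move=> Fi i; rewrite coefN oppr_eq0 => /Fi. Qed.

Lemma int_exps_mono f d : d \is a Num.int -> int_exps (mono f d).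
Proof. by move=> di i; rewrite monoE; case: (i =P d) => [->//|]; rewrite eqxx. Qed.

Lemma int_exps_derY F : int_exps F -> int_exps (derY F).
Proof.
move=> Fi i; rewrite pderivE mulf_eq0 negb_or => /andP[_ /Fi].
by rewrite rpredDr.
Qed.

Lemma int_exps_derX F : int_exps F -> int_exps (derX F).
Proof.
move=> Fi i; rewrite derXE => h; apply: Fi; apply: contraNneq h => ->.
by rewrite der_0.
Qed.

Lemma int_exps_brk F G : int_exps F -> int_exps G -> int_exps (brk F G).
Proof.
move=> Fi Gi; apply: int_expsD.
  by apply: int_expsM; [exact: int_exps_derX|exact: int_exps_derY].
by apply: int_expsN; apply: int_expsM; [exact: int_exps_derY|exact: int_exps_derX].
Qed.

Section Powers.
Variable cp : L -> rat -> L.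
Hypothesis cp_der : forall c a, c != 0 -> c * der (cp c a) = ratr a * cp c a * der c.

Let F_derY F a : F != 0 -> F * derY (ppow cp F a) = ratr a * ppow cp F a * derY F.
Proof. by move=> F0; exact: ppow_pderiv. Qed.

Let F_derX F a : F != 0 -> F * derX (ppow cp F a) = ratr a * ppow cp F a * derX F.
Proof.
move=> F0; apply: (ppow_deriv hL F0 derX_derivation).
rewrite !derX_mono ratr_mono !monoM cp_der ?plc_neq0 //.
by congr mono; ring.
Qed.

Lemma brk_ppow F a : F != 0 -> brk (ppow cp F a) F = 0.
Proof.
(* Multiplied by F, the bracket becomes a F^a [F, F]. *)
move=> F0; apply: (mulfI F0); rewrite mulr0 /brk mulrBr !mulrA F_derX //.
by rewrite F_derY //; ring.
Qed.

(** * Solving H = [K, F] one power of y at a time *)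

Section Solve.
Hypothesis cp0 : forall c, c != 0 -> cp c 0 = 1.
Hypothesis cp1 : forall c, c != 0 -> cp c 1 = c.
Hypothesis cpD : forall c a b, c != 0 -> cp c a * cp c b = cp c (a + b).
Variable V : zmodType.
Variable res : L -> V.
Hypothesis resB : {morph res : f g / f - g}.
Hypothesis res_der : forall f, res (der f) = 0.
Hypothesis res_ratr : forall q f, res f = 0 -> res (ratr q * f) = 0.
Hypothesis res_exact : forall f, res f = 0 -> exists g, der g = f.
Implicit Types (K : puiseux L) (c : L).

Definition tres F : V := res (F (-1)).
Definition traceless F H : Prop := forall a : rat, tres (H * ppow cp F a) = 0.

Let dX_der := derX_derivation.
Let dY_der := derY_derivation.

Lemma tresB F G : tres (F - G) = tres F - tres G.
Proof. by rewrite /tres coefB resB. Qed.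

Lemma tres_brk F G : tres (brk F G) = 0.
Proof.
have r0 : res 0 = 0 by rewrite -der_0 res_der.
rewrite brk_divergence tresB /tres derXE res_der.
by rewrite pderiv_residue r0 subrr.
Qed.

Lemma tres_brk_ppow F K a : F != 0 -> tres (brk K F * ppow cp F a) = 0.
Proof.
move=> F0; rewrite -[RHS](tres_brk (K * ppow cp F a) F) brkMl.
by rewrite brk_ppow // mulr0 addr0.
Qed.

Lemma traceless_step F H K : F != 0 -> traceless F H -> traceless F (H - brk K F).
Proof. by move=> F0 tH a; rewrite mulrBl tresB tH tres_brk_ppow // subrr. Qed.

Lemma int_exps_pdeg F : int_exps F -> F != 0 -> pdeg F \is a Num.int.
Proof. by move=> Fi F0; apply: Fi; exact: plc_neq0. Qed.

Lemma int_exps_ppow F a : int_exps F -> F != 0 -> a * pdeg F \is a Num.int ->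
  int_exps (ppow cp F a).
Proof.
move=> Fi F0 ai k Pk; rewrite -[k](subrK (a * pdeg F)) rpredD //.
exact: ppow_int_exps Pk.
Qed.

(** The substitute for deg F != 0 when F has degree 0 in y: the leading coefficient is not constant,
    and its powers detect every nonzero [h] by a residue. *)
Definition nonconst_lead F : Prop := der (plc F) != 0 /\
  forall h, h != 0 -> exists a, res (h * cp (plc F) a) != 0.

(* The trace of H F^a reads off the leading coefficient of H when the degrees  *)
(* in y add up to -1.                                                          *)
Lemma tres_ppow_lead F H a k : F != 0 -> dle H k -> k + a * pdeg F = - 1 ->
  tres (H * ppow cp F a) = res (H k * cp (plc F) a).
Proof.
move=> F0 Hk ka; rewrite /tres -ka (dleM_lead Hk (@dle_ppow _ cp F F0 a)).
by rewrite ppow_lead.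
Qed.

(** For K = kappa F^a one has [K, F] = kappa' F^a dF/dy, with leading coefficient m kappa' f0^(a+1).
    Matching it with [H k] means kappa' = H_k f0^b / m for b = -(a+1), which is solvable because the
    residue of H_k f0^b is the trace of H F^b. *)
Lemma solve_lead_pdeg F H k : int_exps F -> F != 0 -> pdeg F != 0 ->
  k \is a Num.int -> dle H k -> traceless F H ->
  exists K, [/\ int_exps K, dle K (k + 1 - pdeg F) & brk K F k = H k].
Proof.
set m := pdeg F => Fi F0 m0 ki Hk tH; set f0 := plc F.
have f00 : f0 != 0 by exact: plc_neq0.
pose a := (k + 1 - m) / m; pose b := - (k + 1) / m.
have am : a * m = k + 1 - m by rewrite /a divfK.
have bm : b * m = - (k + 1) by rewrite /b divfK.
have res0 : res (H k * cp f0 b) = 0.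
  by rewrite -(tres_ppow_lead F0 Hk) // -/m bm; ring.
pose r : L := ratr m.
have r0 : r != 0 by rewrite (ratrm_eq0 hL).
have res' : res (ratr m^-1 * (H k * cp f0 b)) = 0 by exact: res_ratr.
have mV : ratr m^-1 = r^-1 :> L.
  by apply: (mulfI r0); rewrite mulfV // /r -hL.2 mulfV // ratrm1.
have [kap kapE] := res_exact res'.
exists (mono kap 0 * ppow cp F a); split.
- apply: int_expsM; first by apply: int_exps_mono.
  by apply: int_exps_ppow; rewrite // -/m am !(rpredB, rpredD) // int_exps_pdeg.
- by rewrite -am -[a * m]add0r; apply: dleM; [exact: dle_mono|exact: dle_ppow].
rewrite brkMl brk_ppow // mulr0 addr0 /brk derX_mono derY_mono.
rewrite ratrm0 mul0r mono_z0 mul0r subr0 kapE.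
have dYd : dle (derY F) (m - 1) := shifts_pderiv (@dle_pdeg _ F).
have -> : k = 0 + (m - 1) + a * m by rewrite am; ring.
rewrite (dleM_lead (dleM (@dle_mono _ _ _) dYd) (@dle_ppow _ cp F F0 a)).
rewrite (dleM_lead (@dle_mono _ _ _) dYd) ppow_lead // -/f0 monoE eqxx am.
rewrite pderivE subrK -/m -[F m]/f0 -/r.
have -> : 0 + (m - 1) + (k + 1 - m) = k by ring.
rewrite mV. have -> : r^-1 * (H k * cp f0 b) * (r * f0) * cp f0 a =
  H k * (cp f0 b * f0 * cp f0 a) by field.
rewrite -{2}(cp1 f00) cpD // cpD //.
have -> : b + 1 + a = 0 by rewrite /a /b; field.
by rewrite cp0 // mulr1.
Qed.

(** Here dF/dy has degree below -1, so for K = q y^(k+1) only - dK/dy dF/dx reaches y^k. This fails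
    for k = -1, where the traces force the coefficient of H to vanish. *)
Lemma solve_lead_pdeg0 F H k : int_exps F -> F != 0 -> pdeg F = 0 -> nonconst_lead F ->
  k \is a Num.int -> dle H k -> traceless F H ->
  exists K, [/\ int_exps K, dle K (k + 1 - pdeg F) & brk K F k = H k].
Proof.
move=> Fi F0 m0 [df0 nd] ki Hk tH; rewrite m0 subr0; set f0 := plc F in df0.
have [k1|k1] := eqVneq (k + 1) 0.
  exists 0; split=> //; first by move=> i; rewrite coef0 eqxx.
  rewrite /brk (deriv_0 dX_der) (deriv_0 dY_der) !mul0r subr0 coef0.
  have [//|h0] := eqVneq (H k) 0; exfalso.
  have [a /eqP] := nd _ h0; apply.
  by rewrite -(tres_ppow_lead F0 Hk) // m0; lra.
have r0 : ratr (k + 1) != 0 :> L by rewrite (ratrm_eq0 hL).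
pose q := - (H k / (ratr (k + 1) * der f0)).
exists (mono q (k + 1)); split.
- by apply: int_exps_mono; rewrite rpredD.
- exact: dle_mono.
rewrite /brk coefB derX_mono derY_mono.
have dYd : dle (derY F) (-1).
  by have := shifts_pderiv (@dle_pdeg _ F); rewrite m0 add0r.
have dXd : dle (derX F) 0.
  by have := shifts_derX (@dle_pdeg _ F); rewrite m0 addr0.
have E1 : (mono (der q) (k + 1) * derY F) k = 0.
  have := dleM_lead (@dle_mono _ (der q) (k + 1)) dYd.
  by rewrite addrK pderivE addNr ratrm0 mul0r mulr0.
have E2 : (mono (ratr (k + 1) * q) (k + 1 - 1) * derX F) k = ratr (k + 1) * q * der f0.
  have := dleM_lead (@dle_mono _ (ratr (k + 1) * q) (k + 1 - 1)) dXd.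
  by rewrite addrK addr0 monoE eqxx derXE /f0 /plc m0.
by rewrite E1 E2 /q; field; rewrite r0 df0.
Qed.

(** Leading terms are removed one after another; the degrees of the corrections drop by one each
    time, so their sum exists and solves the equation. *)
Lemma solve_brk F H : int_exps F -> F != 0 -> pdeg F != 0 \/ nonconst_lead F ->
  int_exps H -> traceless F H -> exists2 K, int_exps K & H = brk K F.
Proof.
move=> Fi F0 Fcase Hi tH; set m := pdeg F.
have [k0 k0i Hk0] : exists2 k, k \is a Num.int & dle H k.
  exists (Num.ceil (pdeg H))%:~R; first exact: rpred_int.
  by apply: dleW (@dle_pdeg _ H) (ceil_ge _).
pose P n H' := [/\ int_exps H', dle H' (k0 - n%:R) & traceless F H'].
(* The correction is made total by the value 0 where the invariant [P] fails, so that a choice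
   function on all pairs exists. *)
have /choice[kap kapP] : forall p : nat * puiseux L, exists K, P p.1 p.2 ->
    [/\ int_exps K, dle K (k0 + 1 - m - p.1%:R) & P p.1.+1 (p.2 - brk K F)].
  case=> n H' /=; have [PH|nPH] := pselect (P n H'); last by exists 0.
  have [H'i H'd tH'] := PH.
  have kni : k0 - n%:R \is a Num.int by rewrite rpredB // rpred_nat.
  have [K [Ki Kd KE]] : exists K, [/\ int_exps K, dle K (k0 - n%:R + 1 - m)
      & brk K F (k0 - n%:R) = H' (k0 - n%:R)].
    have [m0|m0] := eqVneq (pdeg F) 0; last exact: solve_lead_pdeg.
    by apply: solve_lead_pdeg0 => //; case: Fcase => //; rewrite m0 eqxx.
  exists K => _.
  have Kd' : dle K (k0 + 1 - m - n%:R) by apply: dleW Kd _; lra.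
  split=> //; split.
  - by apply: int_expsD => //; apply: int_expsN; exact: int_exps_brk.
  - have -> : k0 - n.+1%:R = k0 - n%:R - 1 by rewrite -natr1; ring.
    apply: dle_int_pred => //.
    + by apply: int_expsD => //; apply: int_expsN; exact: int_exps_brk.
    + apply: dleB => //; apply: dleW (dle_brk Kd (@dle_pdeg _ F)) _.
      by rewrite -/m; lra.
    by rewrite coefB KE subrr.
  exact: traceless_step.
pose Hn := fix Hn n := if n is n'.+1 then Hn n' - brk (kap (n', Hn n')) F else H.
have PHn n : P n (Hn n).
  elim: n => [|n IHn] /=; first by split; rewrite ?subr0.
  by have [] := kapP (n, Hn n) IHn.
pose E n := kap (n, Hn n).
have Ei n : int_exps (E n) by have [] := kapP (n, Hn n) (PHn n).
have Ed n : dle (E n) (k0 + 1 - m - n%:R) by have [] := kapP (n, Hn n) (PHn n).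
have HnE n : Hn n = H - brk (\sum_(i < n) E i) F.
  elim: n => [|n IHn] /=.
    rewrite big_ord0 /brk (deriv_0 dX_der) (deriv_0 dY_der).
    by rewrite !mul0r !subr0.
  by rewrite big_ord_recr /= brkDl -/(E n) {1}IHn; ring.
have [S Si Sd] := int_series_sum Ei Ed; exists S => //.
apply/eqP; rewrite -subr_eq0; apply/eqP.
apply: (dle_eq0 (c := k0) ltr01) => n; rewrite mul1r.
(* The final remainder differs from the n-th one by the bracket of a tail of the sum. *)
have -> : H - brk S F = Hn n - brk (S - \sum_(i < n) E i) F.
  by rewrite HnE brkDl brkNl; ring.
apply: dleB; first by case: (PHn n).
by apply: dleW (dle_brk (Sd n) (@dle_pdeg _ F)) _; rewrite -/m; lra.
Qed.

End Solve.

End Powers.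

End Bracket.

(** * Trace criteria for series in x and y *)

Section TwoVariables.
Variable K : fieldType.
Hypothesis hK : ratr_morph K.
Variable cp : K -> rat -> K.
Hypothesis hcp : scalar_powers cp.
Implicit Types (F G H : puiseux (puiseux K)) (f g : puiseux K).

Notation brk := (brk (@pderiv K)).
Notation cst2 c := (mono (mono c 0) 0).
Notation pow2 := (ppow (ppow cp)).

Let hA : ratr_morph (puiseux K) := ratr_morph_puiseux hK.
Let resf f : K := f (-1).

Let resB : {morph resf : f g / f - g}. Proof. by []. Qed.
Let res_ratr q f : resf f = 0 -> resf (ratr q * f) = 0.
Proof. by move=> f0; rewrite /resf ratr_mono coef_monoM subr0 -/(resf f) f0 mulr0. Qed.

Let pdD := @pderivD K.
Let pdM := pderivM hK.
Let pdr := @pderiv_ratr K.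

Let powE a c : c != 0 -> c * pderiv (ppow cp c a) = ratr a * ppow cp c a * pderiv c.
Proof. by move=> c0; exact: ppow_pderiv. Qed.

Let brk_solve F H := @solve_brk _ hA _ pdD pdM pdr (ppow cp) (fun c a c0 => powE a c0)
  (fun c => ppow0 hK hcp (f := c)) (fun c => ppow1 hK hcp (f := c))
  (fun c a b => ppowD hK hcp (f := c) a b)
  _ resf resB (@pderiv_residue K) res_ratr (@antideriv K hK) F H.

Lemma res_brk_pow2 F G a : F != 0 -> (brk G F * pow2 F a) (-1) (-1) = 0.
Proof.
exact: (@tres_brk_ppow _ hA _ pdD pdM pdr (ppow cp) (fun c a c0 => powE a c0)
  _ resf resB (@pderiv_residue K) F G a).
Qed.

Lemma res_brk F G : (brk F G) (-1) (-1) = 0.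
Proof.
exact: (@tres_brk _ hA _ pdD pdM pdr _ resf resB (@pderiv_residue K) F G).
Qed.

Lemma brk_constl c F : brk (cst2 c) F = 0.
Proof. by apply: brk_const => //; rewrite pderiv_mono ratrm0 mul0r mono_z0. Qed.

Lemma brk_subr_const F G c : brk F (G - cst2 c) = brk F G.
Proof.
rewrite brkC (brkDl hA pdD pdr) (brkNl hA pdD pdM pdr) brk_constl.
by rewrite oppr0 addr0 -brkC.
Qed.

(** For F != 0 this is the negation of [const_leading]. *)
Definition good_lead F : Prop :=
  F != 0 /\ (pdeg F != 0 \/ pdeg (plc F) != 0).

Lemma good_lead_nonconst F : pdeg (plc F) != 0 -> F != 0 ->
  nonconst_lead (@pderiv K) (ppow cp) resf F.
Proof.
move=> d0 F0; have := plc_neq0 F0; rewrite /nonconst_lead.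
move: (plc F) d0 => f0 d0 f00; split.
  apply: contra_neq d0 => /(pderiv_eq0 hK) E.
  apply: pdeg_eq; last by rewrite E; exact: dle_mono.
  by apply: contra_neq f00 => E0; rewrite E E0 mono_z0.
(* This exponent puts the leading term of h f0^a at x^-1. *)
move=> h h0; exists ((-1 - pdeg h) / pdeg f0); set a := _ / _.
have E : pdeg h + a * pdeg f0 = -1 by rewrite /a divfK //; ring.
have := dleM_lead (@dle_pdeg _ h) (@dle_ppow _ cp f0 f00 a).
rewrite E /resf => ->; rewrite mulf_eq0 negb_or plc_neq0 //=.
exact: ppow_lead_neq0.
Qed.

Lemma brk_solvable F H : int_exps F -> int_exps H -> good_lead F ->
  (exists2 G, int_exps G & H = brk G F) <->
  forall a, (H * pow2 F a) (-1) (-1) = 0.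
Proof.
move=> Fi Hi [F0 Fg]; split=> [[G _ ->] a|tH]; first exact: res_brk_pow2.
apply: brk_solve => //; case: Fg; [by left|right].
exact: good_lead_nonconst.
Qed.

Lemma good_lead_shift F : ~ (exists c, F = cst2 c) -> exists c, good_lead (F - cst2 c).
Proof.
move=> Fc; have FB c : F - cst2 c != 0.
  by apply: contra_notN Fc; rewrite subr_eq0 => /eqP ->; exists c.
have [[d0 e0]|nc] := pselect (pdeg F = 0 /\ pdeg (plc F) = 0); last first.
  exists 0; rewrite !mono_z0 subr0; split.
    by have := FB 0; rewrite !mono_z0 subr0.
  have [d0|nd] := eqVneq (pdeg F) 0; last by left.
  by right; apply/eqP => e0; apply: nc.
(* When both degrees are 0 the leading term is the constant [F 0 0]; once it is subtracted, both
   degrees cannot be 0 again. *)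
exists (F 0 0); set c := F 0 0; set F' := F - cst2 c; split; first exact: FB.
have [p0|np] := eqVneq (pdeg F') 0; last by left.
right; apply/eqP => q0; have := plc_neq0 (plc_neq0 (FB c)).
rewrite -/F' {1}/plc q0 /plc p0.
have -> : F' 0 = F 0 - mono c 0 by rewrite /F' coefB monoE eqxx.
by rewrite coefB monoE eqxx /c subrr eqxx.
Qed.

Lemma not_const_of_brk F G J : J != 0 -> brk F G = cst2 J -> ~ exists c, F = cst2 c.
Proof.
move=> J0 FG [c Fc]; case/eqP: J0.
have E : cst2 J = 0 :> puiseux (puiseux K) by rewrite -FG Fc brk_constl.
have E0 : mono J 0 = 0 :> puiseux K.
  have := congr1 (fun h : puiseux (puiseux K) => h 0) E.
  by rewrite [X in X = _]monoE eqxx.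
have := congr1 (fun h : puiseux K => h 0) E0.
by rewrite [X in X = _]monoE eqxx.
Qed.

(** Brackets do not see constants, so F may be replaced by the shift that [good_lead_shift]
    provides. *)
Lemma brk_solvable_shift F H : int_exps F -> int_exps H -> ~ (exists c, F = cst2 c) ->
  (exists2 G, int_exps G & H = brk G F) <->
  forall a c, (H * pow2 (F - cst2 c) a) (-1) (-1) = 0.
Proof.
move=> Fi Hi Fc; split=> [[G _ ->] a c|tH].
  rewrite -(brk_subr_const G F c); apply: res_brk_pow2.
  by apply: contra_notN Fc; rewrite subr_eq0 => /eqP ->; exists c.
have [c gc] := good_lead_shift Fc.
have Fi' : int_exps (F - cst2 c).
  by apply: int_expsD => //; apply: int_expsN; apply: int_exps_mono.
have [_ /(_ (tH^~ c))[G Gi GE]] := brk_solvable Fi' Hi gc.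
exists G; first exact: Gi.
exact: (etrans GE (brk_subr_const G F c)).
Qed.

(** After scaling by J, being Jacobian means that 1 is a bracket [G, F]: the case H = 1 of
    [brk_solvable_shift]. *)
Lemma jacobian_element_trace F : int_exps F ->
  (int_exps F /\ exists2 G, int_exps G & exists2 J, J != 0 & brk F G = cst2 J) <->
  ~ (exists c, F = cst2 c) /\ forall a c, (pow2 (F - cst2 c) a) (-1) (-1) = 0.
Proof.
move=> Fi; have E1 : (1 : puiseux (puiseux K)) = cst2 1 by [].
have i1 : int_exps (1 : puiseux (puiseux K)) by rewrite E1; exact: int_exps_mono.
split=> [[_ [G Gi [J J0 FG]]]|[Fc tF]].
  have Fc := not_const_of_brk J0 FG; split=> // a c.
  have [/(_ _)tr1 _] := brk_solvable_shift Fi i1 Fc.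
  rewrite -[pow2 _ _]mul1r; apply: tr1.
  exists (cst2 (- J^-1) * G).
    by apply: int_expsM; [exact: int_exps_mono|exact: Gi].
  rewrite (brkMl hA pdD pdM pdr) brk_constl mul0r add0r brkC FG.
  by rewrite mulrN monoM monoM !addr0 -monoN -monoN mulNr opprK mulVf.
split=> //; have [_ H] := brk_solvable_shift Fi i1 Fc.
have [|G Gi GE] := H; first by move=> a c; rewrite mul1r.
exists G => //; exists (-1); first by rewrite oppr_eq0 oner_neq0.
by rewrite brkC -GE E1 -monoN -monoN.
Qed.

(** The bracket [H G, F] = [H, F] G - H has trace zero. *)
Lemma brk_adjoint_trace F G H : brk F G = 1 ->
  (brk H F * G) (-1) (-1) = H (-1) (-1).
Proof.
move=> FG; have := res_brk (H * G) F; rewrite (brkMl hA pdD pdM pdr).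
rewrite (brkC _ G F) FG mulrN1; set X := brk H F * G.
rewrite -[(X - H) _ _]/(X (-1) (-1) - H (-1) (-1)) => /eqP.
by rewrite subr_eq0 => /eqP.
Qed.

End TwoVariables.

(** * Substitution x := u *)

Section Grid.
Variable K : zmodType.

Lemma ramified_grid (F : rat -> K) (b : int) (c : rat) : 0 < b ->
  (forall i, F i != 0 -> b%:~R * i \is a Num.int /\ i <= c) ->
  ramified_by (Num.ceil c) b F.
Proof.
move=> b0 Fi i /Fi[bi ic]; have b0' : (0 : rat) < b%:~R by rewrite ltr0z.
have /Num.Theory.intrP[z iz] := bi.
have zc : z <= Num.ceil c * b.
  rewrite -(ler_int rat) -iz mulrC intrM ler_pM2r //.
  exact: le_trans ic (ceil_ge _).
exists `|(Num.ceil c * b - z)%R|%N.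
rewrite natr_absz ger0_norm ?subr_ge0 // intrB intrM -iz; field.
by rewrite gt_eqF.
Qed.

Lemma grid_ramified (f : puiseux K) : exists2 b : int, 0 < b &
  forall i, f i != 0 -> b%:~R * i \is a Num.int.
Proof.
have [a [b [b0 fab]]] := ramifiedP f; exists b => // i /fab[n ->].
have b0' : (b%:~R : rat) != 0 by rewrite intr_eq0 gt_eqF.
rewrite mulrBr mulrCA mulfV // mulr1 -intrM rpredB ?rpred_int //.
by rewrite rpred_nat.
Qed.

Lemma finite_above (f : puiseux K) d : finite_set [set k | f k != 0 /\ d < k]%classic.
Proof.
have [s sd] := trunc f d; apply: sub_finite_set (finite_seq s) => k [fk dk] /=.
apply: contraT => ks; have := sd k dk; rewrite coefB coef_sum big_seq big1; last first.
  move=> j js; rewrite monoE; case: (k =P j) => // kj.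
  by rewrite kj js in ks.
by rewrite subr0 => /eqP; rewrite (negPf fk).
Qed.

Lemma psum_seq (E : rat -> puiseux K) i (r : seq rat) : summable E -> uniq r ->
  (forall k, k \notin r -> E k i = 0) -> psum E i = \sum_(k <- r) E k i.
Proof.
move=> sE ur rE; rewrite psumE //.
rewrite (@bigfs _ _ _ _ r xpredT) => [|//|k _]; last exact: rE.
by congr (\sum_(k \in _) _); apply/seteqP; split.
Qed.

Lemma summable_seq (E : rat -> puiseux K) i : summable E ->
  exists2 r : seq rat, uniq r & forall k, E k i != 0 -> k \in r.
Proof.
move=> [_ /(_ i)/finite_seqP[r Er]]; exists (undup r); first exact: undup_uniq.
move=> k Ek; rewrite mem_undup.
by have : [set k | E k i != 0]%classic k by []; rewrite Er.
Qed.

Lemma psumD (E1 E2 E : rat -> puiseux K) : summable E1 -> summable E2 -> summable E ->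
  (forall k, E k = E1 k + E2 k) -> psum E = psum E1 + psum E2.
Proof.
move=> s1 s2 s3 EE; apply/puiseuxP => i.
have [r1 u1 h1] := summable_seq i s1; have [r2 u2 h2] := summable_seq i s2.
have z1 k : k \notin undup (r1 ++ r2) -> E1 k i = 0.
  rewrite mem_undup mem_cat negb_or => /andP[k1 _]; apply/eqP.
  by apply: contraNT k1; exact: h1.
have z2 k : k \notin undup (r1 ++ r2) -> E2 k i = 0.
  rewrite mem_undup mem_cat negb_or => /andP[_ k2]; apply/eqP.
  by apply: contraNT k2; exact: h2.
have z k : k \notin undup (r1 ++ r2) -> E k i = 0.
  by move=> kr; rewrite EE coefD z1 // z2 // addr0.
rewrite coefD (psum_seq s1 _ z1) ?undup_uniq // (psum_seq s2 _ z2) ?undup_uniq //.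
rewrite (psum_seq s3 _ z) ?undup_uniq // -big_split /=.
by apply: eq_bigr => k _; rewrite EE.
Qed.

End Grid.

Section FinSupport.
Variable K : fieldType.
Implicit Types f : puiseux K.

Lemma finsupp_pderiv f : finsupp f -> finsupp (pderiv f).
Proof.
move=> /finite_seqP[s fs]; apply: sub_finite_set (finite_seq [seq i - 1 | i <- s]) => k.
rewrite /mkset pderivE mulf_eq0 negb_or => /andP[_ fk].
apply/mapP; exists (k + 1); last by rewrite addrK.
by have : [set i | f i != 0]%classic (k + 1) by []; rewrite fs.
Qed.

Lemma finsupp_integ f : finsupp f -> finsupp (integ f).
Proof.
move=> /finite_seqP[s fs]; apply: sub_finite_set (finite_seq [seq i + 1 | i <- s]) => k.
rewrite /mkset integE mulf_eq0 negb_or => /andP[_ fk].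
apply/mapP; exists (k - 1); last by rewrite subrK.
by have : [set i | f i != 0]%classic (k - 1) by []; rewrite fs.
Qed.

End FinSupport.

Section Substitution.
Variable K : fieldType.
Hypothesis hK : ratr_morph K.
Variable cp : K -> rat -> K.
Hypothesis hcp : scalar_powers cp.
Variable u : puiseux K.
Implicit Types f g : puiseux K.

Let p := ppow cp u.

Definition subst_family f (i : rat) : puiseux K := mono (f i) 0 * p i.
Definition subst f : puiseux K := psum (subst_family f).

(* The two cases where the family f_i u^i is summable, for u <> 0. *)
Definition subst_ok f : Prop := 0 < pdeg u \/ finsupp f.

Lemma subst_okD f g : subst_ok f -> subst_ok g -> subst_ok (f + g).
Proof. by move=> [|ff]; [left|move=> [|fg]; [left|right; exact: finsuppD]]. Qed.

Lemma subst_okN f : subst_ok f -> subst_ok (- f).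
Proof. by move=> [|ff]; [left|right; exact: finsuppN]. Qed.

Lemma subst_okM f g : subst_ok f -> subst_ok g -> subst_ok (f * g).
Proof. by move=> [|ff]; [left|move=> [|fg]; [left|right; exact: finsuppM]]. Qed.

Lemma subst_ok_mono c d : subst_ok (mono c d).
Proof. by right; exact: finsupp_mono. Qed.

Lemma subst_ok_pderiv f : subst_ok f -> subst_ok (pderiv f).
Proof. by move=> [|ff]; [left|right; exact: finsupp_pderiv]. Qed.

Lemma subst_ok_integ f : subst_ok f -> subst_ok (integ f).
Proof. by move=> [|ff]; [left|right; exact: finsupp_integ]. Qed.

Hypothesis u0 : u != 0.

(** The term f_k u^k has a nonzero coefficient at k deg u. If deg u = 0 these exponents coincide, so
    finitely many k occur; if deg u < 0 the common upper bound bounds k from below. *)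
Lemma subst_ok_of_summable f : summable (subst_family f) -> subst_ok f.
Proof.
move=> [[a [b [b0 Eab]]] Efin]; have [|d0] := ltP 0 (pdeg u); [by left|right].
have lead k : f k != 0 -> subst_family f k (k * pdeg u) != 0.
  move=> fk; rewrite coef_monoM subr0 mulf_neq0 //; exact: ppow_lead_neq0.
move: d0; rewrite le_eqVlt => /orP[/eqP d0|d0].
  apply: sub_finite_set (Efin 0) => k /= fk.
  by have := lead _ fk; rewrite d0 mulr0.
(* The bound in [finite_above] is strict, hence the shift by 1. *)
apply: sub_finite_set (finite_above f (a%:~R / pdeg u - 1)) => k fk; split=> //.
have [n kn] := Eab k _ (lead k fk).
have : k * pdeg u <= a%:~R.
  by rewrite kn gerBl divr_ge0 ?ler0n // ler0z ltW.
rewrite -ler_ndivrMr // => h; lra.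
Qed.

Lemma subst_family_le f k i : subst_family f k i != 0 -> f k != 0 /\ i <= k * pdeg u.
Proof.
rewrite coef_monoM subr0 mulf_eq0 negb_or => /andP[fk pk]; split=> //.
exact: dle_coef (@dle_ppow _ cp u u0 k) pk.
Qed.

Lemma summable_of_subst_ok f : subst_ok f -> summable (subst_family f).
Proof.
move=> Sf; have [C fC] : exists C, forall k, f k != 0 -> k * pdeg u <= C.
  case: Sf => [d0|/finite_seqP[s fs]].
    exists (pdeg f * pdeg u) => k fk; rewrite ler_pM2r //.
    exact: dle_coef (@dle_pdeg _ f) fk.
  exists (\sum_(k <- undup s) `|k * pdeg u|) => k fk.
  have ks : k \in undup s.
    by have : [set i | f i != 0]%classic k by []; rewrite fs /= mem_undup.
  rewrite (bigD1_seq k) ?undup_uniq //=; apply: le_trans (ler_norm _) _.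
  by rewrite lerDl sumr_ge0.
split.
  have [bu bu0 bup] := grid_ramified u; have [bf bf0 bfp] := grid_ramified f.
  pose q := denq (pdeg u); have q0 : 0 < q := denq_gt0 _.
  (* An exponent of f_k u^k is k deg u plus a multiple of 1/bu; bf and q clear the denominators of k
     and deg u. *)
  exists (Num.ceil C), (bu * bf * q); split; first by rewrite !mulr_gt0.
  move=> k; apply: ramified_grid => [|i Ei]; first by rewrite !mulr_gt0.
  have [fk ik] := subst_family_le Ei; split; last exact: le_trans ik (fC _ fk).
  have pk : p k i != 0.
    by move: Ei; rewrite coef_monoM subr0 mulf_eq0 negb_or => /andP[].
  have g1 : bu%:~R * (i - k * pdeg u) \is a Num.int := ppow_exps u0 bup pk.
  have g2 : bf%:~R * k \is a Num.int := bfp _ fk.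
  have g3 : q%:~R * pdeg u \is a Num.int.
    by rewrite mulrC /q -numqE rpred_int.
  have -> : (bu * bf * q)%:~R * i = (bf * q)%:~R * (bu%:~R * (i - k * pdeg u))
      + bu%:~R * ((bf%:~R * k) * (q%:~R * pdeg u)).
    by rewrite !intrM; ring.
  by rewrite rpredD // rpredM ?rpred_int // rpredM.
move=> i; case: Sf => [d0|ff].
  apply: sub_finite_set (finite_above f (i / pdeg u - 1)) => k /= /subst_family_le[fk ik].
  by split=> //; rewrite -ler_pdivrMr // in ik; lra.
by apply: sub_finite_set ff => k /= /subst_family_le[].
Qed.

Lemma substD f g : subst_ok f -> subst_ok g -> subst (f + g) = subst f + subst g.
Proof.
move=> Sf Sg; apply: psumD; try exact: summable_of_subst_ok.
  by apply: summable_of_subst_ok; exact: subst_okD.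
by move=> k; rewrite /subst_family coefD monoD mulrDl.
Qed.

Lemma subst_mono c d : subst (mono c d) = mono c 0 * p d.
Proof.
apply/puiseuxP => i; rewrite (psum_seq (r := [:: d])) //.
- by rewrite big_seq1 /subst_family monoE eqxx.
- exact/summable_of_subst_ok/subst_ok_mono.
move=> k; rewrite inE => kd.
by rewrite /subst_family monoE (negPf kd) mono_z0 mul0r coef0.
Qed.

Lemma dle_subst f d : 0 < pdeg u -> dle f d -> dle (subst f) (d * pdeg u).
Proof.
move=> d0 fd i di; have sf : subst_ok f by left.
rewrite (psum_seq (r := [::])) ?big_nil //; first exact: summable_of_subst_ok.
move=> k _; apply/eqP; apply: contraTT di => /subst_family_le[fk ik].
by rewrite -leNgt; apply: le_trans ik _; rewrite ler_pM2r // (dle_coef fd).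
Qed.

Lemma subst_density (T : puiseux K -> puiseux K) :
  (forall f g, subst_ok f -> subst_ok g -> T (f + g) = T f + T g) ->
  (forall c d, T (mono c d) = 0) ->
  (0 < pdeg u -> exists C, forall f d, dle f d -> dle (T f) (d * pdeg u + C)) ->
  forall f, subst_ok f -> T f = 0.
Proof.
move=> TD Tm Tc; apply: density.
- split; [by right; exact: finsupp0|exact: subst_okN|exact: subst_okD|exact: TD].
- by move=> f d _; split; [exact: subst_ok_mono|exact: Tm].
have [d0|d0] := ltP 0 (pdeg u); [right|left].
  have [C CP] := Tc d0; exists (pdeg u), C; split=> // f d _ fd.
  by rewrite mulrC; exact: CP.
by move=> f [|//]; rewrite ltNge d0.
Qed.

Lemma subst_monoM c d c' d' :
  subst (mono c d * mono c' d') = subst (mono c d) * subst (mono c' d').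
Proof.
rewrite monoM !subst_mono /p -(ppowD hK hcp) // -[in LHS](addr0 0) -monoM.
exact: mulrACA.
Qed.

(** The defect is additive in each factor and vanishes on monomials by the law of exponents for u;
    density is applied to each factor in turn. *)
Lemma substM f g : subst_ok f -> subst_ok g -> subst (f * g) = subst f * subst g.
Proof.
pose T f g := subst (f * g) - subst f * subst g.
have Tc f' g' d d' : 0 < pdeg u -> dle f' d -> dle g' d' ->
    dle (T f' g') (d * pdeg u + d' * pdeg u).
  move=> d0 fd gd; apply: dleB; first by rewrite -mulrDl; apply: dle_subst => //; exact: dleM.
  by apply: dleM; apply: dle_subst.
have Tm c' d' f' : subst_ok f' -> T f' (mono c' d') = 0.
  apply: (@subst_density (T^~ (mono c' d'))).
  - move=> h k Sh Sk; have Sm := subst_ok_mono c' d'.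
    rewrite /T mulrDl (substD (subst_okM Sh Sm) (subst_okM Sk Sm)) (substD Sh Sk).
    by rewrite mulrDl opprD addrACA.
  - by move=> c d; rewrite /T subst_monoM subrr.
  by move=> d0; exists (d' * pdeg u) => h d hd; apply: Tc => //; exact: dle_mono.
move=> Sf Sg; apply/eqP; rewrite -subr_eq0; apply/eqP; move: g Sg.
apply: (@subst_density (T f)).
- move=> h k Sh Sk; rewrite /T mulrDr (substD (subst_okM Sf Sh) (subst_okM Sf Sk)).
  by rewrite (substD Sh Sk) mulrDr opprD addrACA.
- by move=> c d; exact: Tm.
move=> d0; exists (pdeg f * pdeg u) => h d hd.
by rewrite addrC; apply: Tc => //; exact: dle_pdeg.
Qed.

(** By density it is enough to treat x^d, where the chain rule is the logarithmic derivative of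
    u^d. *)
Lemma subst_pderiv f : subst_ok f -> pderiv (subst f) = subst (pderiv f) * pderiv u.
Proof.
move=> Sf; apply/eqP; rewrite -subr_eq0; apply/eqP; move: f Sf.
apply: (@subst_density (fun f => pderiv (subst f) - subst (pderiv f) * pderiv u)).
- move=> h k Sh Sk; rewrite (substD Sh Sk) !pderivD.
  rewrite (substD (subst_ok_pderiv Sh) (subst_ok_pderiv Sk)).
  by rewrite mulrDl opprD addrACA.
- move=> c d; rewrite pderiv_mono !subst_mono (pderivM hK) pderiv_mono ratrm0 mul0r mono_z0.
  rewrite mul0r add0r; apply/eqP; rewrite subr_eq0; apply/eqP; apply: (mulfI u0).
  have E : u * pderiv (p d) = ratr d * p d * pderiv u := ppow_pderiv hK cp u0 d.
  have pd : p d = p (d - 1) * u.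
    by have := ppowD hK hcp (d - 1) 1 u0; rewrite subrK (ppow1 hK hcp u0).
  have -> : u * (mono c 0 * pderiv (p d)) = mono c 0 * (u * pderiv (p d)).
    exact: mulrCA.
  rewrite {}E {}pd ratr_mono -[in RHS](addr0 0) -monoM.
  move: (mono (ratr d) 0) (mono c 0) (p (d - 1)) (pderiv u) => x y z w.
  by ring.
(* The resulting constant is the larger of -1, the shift for the derivative of f(u), and deg u' -
   deg u, the shift for f'(u) u'. *)
move=> d0; pose x := pdeg u - 1 - pdeg (pderiv u); pose y := Num.max x 0.
have xy : x <= y by rewrite le_max lexx.
have y0 : 0 <= y by rewrite le_max lexx orbT.
exists (pdeg (pderiv u) - pdeg u + y) => f d fd; apply: dleB.
  by apply: dleW (shifts_pderiv (dle_subst d0 fd)) _; rewrite /x in xy; lra.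
apply: dleW (dleM (dle_subst d0 (shifts_pderiv fd)) (@dle_pdeg _ (pderiv u))) _.
lra.
Qed.

End Substitution.

(** * Substitution x := u, y := v in polynomials in y *)

Section Substitution2.
Variables L K : fieldType.
Hypotheses (hL : ratr_morph L) (hK : ratr_morph K).
Variable der : L -> L.
Hypothesis dD : {morph der : f g / f + g}.
Hypothesis dM : forall f g, der (f * g) = der f * g + f * der g.
Hypothesis dr : forall q : rat, der (ratr q) = 0.
Variable S : L -> Prop.
Hypothesis Sr : forall q : rat, S (ratr q).
Hypothesis SN : forall f, S f -> S (- f).
Hypothesis SD : forall f g, S f -> S g -> S (f + g).
Hypothesis SM : forall f g, S f -> S g -> S (f * g).
Hypothesis Sder : forall f, S f -> S (der f).
Variable e : L -> puiseux K.
Hypothesis eD : forall f g, S f -> S g -> e (f + g) = e f + e g.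
Hypothesis eM : forall f g, S f -> S g -> e (f * g) = e f * e g.
Hypothesis er : forall q : rat, e (ratr q) = ratr q.
Variables u' v : puiseux K.
Hypothesis e_der : forall f, S f -> pderiv (e f) = e (der f) * u'.
Implicit Types F G : puiseux L.

(** [e] stands for x := u on the class [S] of coefficients where this substitution converges, and
    [u'] for the derivative of u. *)
Definition subst2 F : puiseux K := \sum_(j \in [set: nat]) e (F j%:R) * v ^+ j.

Definition subst2_ok F : Prop := nat_exps F /\ forall j, S (F j).

Lemma nat_exps_bound F : exists N : nat, forall j : nat, (N <= j)%N -> F j%:R = 0.
Proof.
exists (Num.bound `|pdeg F|) => j Nj; apply: (@dle_pdeg _ F).
apply: le_lt_trans (ler_norm _) _; apply: lt_le_trans (archi_boundP _) _.
  exact: normr_ge0.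
by rewrite ler_nat.
Qed.

Lemma nat_exps_sum F N : nat_exps F -> (forall j : nat, (N <= j)%N -> F j%:R = 0) ->
  F = \sum_(j < N) mono (F j%:R) j%:R.
Proof.
move=> Fn FN; apply/puiseuxP => k.
have natI : injective (fun j : nat => j%:R : rat).
  by move=> i j /eqP; rewrite eqr_nat => /eqP.
pose s : seq rat := [seq j%:R | j <- iota 0 N].
have us : uniq s by rewrite map_inj_uniq // iota_uniq.
have := sum_mono_coef F k us.
rewrite big_map -[N in iota 0 N]subn0 big_mkord => ->.
case: ifPn => // kN; have [//|Fk] := eqVneq (F k) 0.
have /Num.Theory.natrP[j kj] := Fn _ Fk.
have [jN|Nj] := ltnP j N; last by rewrite kj FN.
by case/negP: kN; apply/mapP; exists j; rewrite // mem_iota add0n.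
Qed.

Let S0 : S 0. Proof. by rewrite -ratrm0. Qed.
Let e0 : e 0 = 0. Proof. by rewrite -[0 in LHS]ratrm0 er ratrm0. Qed.

Lemma subst2E F N : (forall j : nat, (N <= j)%N -> F j%:R = 0) ->
  subst2 F = \sum_(j < N) e (F j%:R) * v ^+ j.
Proof.
move=> FN; rewrite /subst2 (fsbig_ord _ _ (fun j => e (F j%:R) * v ^+ j)).
rewrite -(fsbig_widen `I_N%classic setT) // => j [_ /= /negP].
by rewrite -leqNgt => Nj; rewrite /preimage /= FN // e0 mul0r.
Qed.

Lemma subst2D F G : subst2_ok F -> subst2_ok G -> subst2 (F + G) = subst2 F + subst2 G.
Proof.
move=> [_ SFj] [_ SGj]; have [N FN] := nat_exps_bound F; have [N' GN] := nat_exps_bound G.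
have FN1 j : (maxn N N' <= j)%N -> F j%:R = 0.
  by move=> Nj; apply/FN/leq_trans/Nj/leq_maxl.
have GN1 j : (maxn N N' <= j)%N -> G j%:R = 0.
  by move=> Nj; apply/GN/leq_trans/Nj/leq_maxr.
rewrite (subst2E FN1) (subst2E GN1) (@subst2E _ (maxn N N')); last first.
  by move=> j Nj; rewrite coefD FN1 // GN1 // addr0.
rewrite -big_split; apply: eq_bigr => j _.
by rewrite coefD eD // mulrDl.
Qed.

Lemma subst2_mono f (j : nat) : subst2 (mono f j%:R) = e f * v ^+ j.
Proof.
rewrite (@subst2E _ j.+1) => [|l jl]; last first.
  by rewrite monoE eqr_nat gtn_eqF.
rewrite big_ord_recr big1 /= => [|i _]; first by rewrite add0r monoE eqxx.
by rewrite monoE eqr_nat ltn_eqF // e0 mul0r.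
Qed.

Lemma subst2_okN F : subst2_ok F -> subst2_ok (- F).
Proof.
move=> [Fn SFj]; split=> j; last by rewrite coefN; exact: SN.
by rewrite coefN oppr_eq0; exact: Fn.
Qed.

Lemma subst2_okD F G : subst2_ok F -> subst2_ok G -> subst2_ok (F + G).
Proof.
move=> [Fn SFj] [Gn SGj]; split=> j; rewrite coefD; last exact: SD.
by have [->|/Fn//] := eqVneq (F j) 0; rewrite add0r; exact: Gn.
Qed.

Lemma subst2_ok_mono f (j : nat) : S f -> subst2_ok (mono f j%:R).
Proof.
move=> Sf; split=> i; rewrite monoE; case: (i =P j%:R) => // [->|] //.
by rewrite eqxx.
Qed.

Lemma subst2_ok0 : subst2_ok 0.
Proof. by split=> j; rewrite coef0 ?eqxx. Qed.

Lemma subst2_ok_sum (I : Type) (r : seq I) (E : I -> puiseux L) :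
  (forall i, subst2_ok (E i)) -> subst2_ok (\sum_(i <- r) E i).
Proof. by move=> SE; elim/big_ind: _ => //; [exact: subst2_ok0|exact: subst2_okD]. Qed.

Lemma subst2_okM F G : subst2_ok F -> subst2_ok G -> subst2_ok (F * G).
Proof.
move=> [Fn SFj] [Gn SGj].
have [N FN] := nat_exps_bound F; have [N' GN] := nat_exps_bound G.
rewrite (nat_exps_sum Fn FN) (nat_exps_sum Gn GN) mulr_suml.
apply: subst2_ok_sum => i; rewrite mulr_sumr; apply: subst2_ok_sum => j.
by rewrite monoM -natrD; apply: subst2_ok_mono; exact: SM.
Qed.

Lemma subst2_ok_derX F : subst2_ok F -> subst2_ok (derX der F).
Proof.
move=> [Fn SFj]; split=> j; rewrite derXE //; last exact: Sder.
by move=> h; apply: Fn; apply: contraNneq h => ->; rewrite der_0.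
Qed.

Lemma subst2_ok_derY F : subst2_ok F -> subst2_ok (derY F).
Proof.
move=> [Fn SFj]; split=> j; rewrite pderivE; last exact: SM.
rewrite mulf_eq0 negb_or ratrm_eq0 // => /andP[j1 /Fn/Num.Theory.natrP[n jn]].
move: jn; case: n => [|n] jn; first by rewrite jn eqxx in j1.
by rewrite -[j](addrK 1) jn -natr1 addrK rpred_nat.
Qed.

(** Polynomials in y are finite sums of monomials, so additivity suffices without continuity. *)
Lemma subst2_additive_eq0 (T : puiseux L -> puiseux K) :
  (forall F G, subst2_ok F -> subst2_ok G -> T (F + G) = T F + T G) ->
  (forall f (j : nat), S f -> T (mono f j%:R) = 0) -> forall F, subst2_ok F -> T F = 0.
Proof.
move=> TD Tm; have T0 : T 0 = 0.
  by apply: (addrI (T 0)); rewrite -TD ?addr0 //; exact: subst2_ok0.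
apply: density.
- split; [exact: subst2_ok0|exact: subst2_okN|exact: subst2_okD|exact: TD].
- move=> F d [Fn SFj]; have [->|/Fn/Num.Theory.natrP[n ->]] := eqVneq (F d) 0.
    by rewrite mono_z0; split; [exact: subst2_ok0|].
  by split; [exact: subst2_ok_mono|exact: Tm].
left=> F [Fn _]; have [N FN] := nat_exps_bound F.
rewrite (nat_exps_sum Fn FN); apply: finsupp_sumr => i; exact: finsupp_mono.
Qed.

Lemma subst2M F G : subst2_ok F -> subst2_ok G -> subst2 (F * G) = subst2 F * subst2 G.
Proof.
pose T F G := subst2 (F * G) - subst2 F * subst2 G.
have Tm f (j : nat) H : S f -> subst2_ok H -> T H (mono f j%:R) = 0.
  move=> Sf; apply: (subst2_additive_eq0 (T := T^~ (mono f j%:R))).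
    move=> F1 F2 S1 S2; have Sm := subst2_ok_mono j Sf; rewrite /T mulrDl.
    rewrite (subst2D (subst2_okM S1 Sm) (subst2_okM S2 Sm)) (subst2D S1 S2) mulrDl.
    by rewrite opprD addrACA.
  move=> g i Sg; rewrite /T monoM -natrD !subst2_mono eM // exprD mulrACA.
  exact: subrr.
move=> SFF SFG; apply/eqP; rewrite -subr_eq0; apply/eqP; move: G SFG.
apply: (subst2_additive_eq0 (T := T F)); last by move=> f j Sf; exact: Tm.
move=> F1 F2 S1 S2; rewrite /T mulrDr (subst2D (subst2_okM SFF S1) (subst2_okM SFF S2)).
by rewrite (subst2D S1 S2) mulrDr opprD addrACA.
Qed.

Lemma subst2_pderiv F : subst2_ok F -> pderiv (subst2 F) =
  subst2 (derX der F) * u' + subst2 (derY F) * pderiv v.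
Proof.
move=> SFF; apply/eqP; rewrite -subr_eq0; apply/eqP; move: F SFF.
apply: (subst2_additive_eq0 (T := fun F => pderiv (subst2 F) -
  (subst2 (derX der F) * u' + subst2 (derY F) * pderiv v))).
  move=> F1 F2 S1 S2; rewrite (subst2D S1 S2) derXD // derYD // pderivD.
  rewrite (subst2D (subst2_ok_derX S1) (subst2_ok_derX S2)).
  rewrite (subst2D (subst2_ok_derY S1) (subst2_ok_derY S2)).
  move: (subst2 _) (subst2 _) (pderiv _) (pderiv _) (pderiv _) => x y z w t.
  move: (subst2 _) (subst2 _) => x' y'; ring.
move=> f j Sf; rewrite derX_mono // derY_mono !subst2_mono (pderivM hK).
rewrite (deriv_X (pderiv_derivation hK)) e_der //.
case: j => [|j].
  rewrite ratrm0 !mul0r mono_z0 /=.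
  have -> : subst2 0 = 0 by rewrite -(mono_z0 _ 0%:R) subst2_mono e0 mul0r.
  move: (e _) (pderiv v) => x y; ring.
have -> : j.+1%:R - 1 = j%:R :> rat by rewrite -natr1 addrK.
rewrite subst2_mono eM // er ratr_nat /=.
move: (e f) (e _) (v ^+ _) (v ^+ _) (pderiv v) => x y z w t; ring.
Qed.

(** * Potentials of closed forms and their pullback *)

Section Potential.
Variable exactf : L -> Prop.
Hypothesis Sint : forall f, S f -> exactf f -> exists g, S g /\ der g = f.

(** P integrates A in x. Closedness makes B - dP/dy independent of x, and Q integrates this
    difference in y, where the new exponents j + 1 are nonzero. *)
Lemma closed_form_exact A B : subst2_ok A -> subst2_ok B -> derY A = derX der B ->
  (forall j, exactf (A j)) -> exists W, [/\ subst2_ok W, derX der W = A & derY W = B].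
Proof.
move=> SA SB AB rA.
have /choice[kap kapP] : forall j : nat, exists g, S g /\ der g = A j%:R.
  by move=> j; apply: Sint => //; case: SA.
have [N AN] := nat_exps_bound A.
pose P := \sum_(j < N) mono (kap j) j%:R.
have SP : subst2_ok P by apply: subst2_ok_sum => j; apply: subst2_ok_mono; case: (kapP j).
have XP : derX der P = A.
  rewrite [RHS](nat_exps_sum _ AN); last by case: SA.
  rewrite /P (big_morph _ (derXD dD dr) (deriv_0 (derX_derivation dD dM dr))).
  by apply: eq_bigr => j _; rewrite derX_mono //; case: (kapP j) => _ ->.
pose q := B - derY P.
have Sq : subst2_ok q by apply: subst2_okD => //; apply: subst2_okN; exact: subst2_ok_derY.
have Xq : derX der q = 0.
  rewrite /q (deriv_B (derX_derivation dD dM dr)) (derXY dM dr) XP AB.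
  exact: subrr.
have [N' qN] := nat_exps_bound q.
pose Q := \sum_(j < N') mono (ratr j.+1%:R^-1 * q j%:R) j.+1%:R.
have SQ : subst2_ok Q.
  by apply: subst2_ok_sum => j; apply: subst2_ok_mono; apply: SM => //; case: Sq.
have XQ : derX der Q = 0.
  rewrite /Q (big_morph _ (derXD dD dr) (deriv_0 (derX_derivation dD dM dr))).
  rewrite big1 // => j _; rewrite derX_mono // dM dr mul0r add0r.
  have -> : der (q j%:R) = 0 by rewrite -derXE // Xq coef0.
  by rewrite mulr0 mono_z0.
have YQ : derY Q = q.
  rewrite [RHS](nat_exps_sum _ qN); last by case: Sq.
  rewrite /Q (big_morph _ (derYD hL) (deriv_0 (derY_derivation hL))).
  apply: eq_bigr => j _; rewrite derY_mono mulrA -hL.2 mulfV ?pnatr_eq0 //.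
  by rewrite ratrm1 mul1r -natr1 addrK.
exists (P + Q); split; first exact: subst2_okD.
  by rewrite derXD // XP XQ addr0.
by rewrite derYD // YQ /q addrC subrK.
Qed.

(** A dx + B dy is the form F dG - c x dy, and dA/dy - dB/dx = c - [F, G] = 0. The potential is
    pulled back by the chain rule. *)
Lemma subst2_form_exact F G (c x : L) : subst2_ok F -> subst2_ok G -> S c -> S x ->
  der c = 0 -> der x = 1 -> brk der F G = mono c 0 ->
  (forall j, exactf ((F * derX der G) j)) ->
  exists W, subst2 F * pderiv (subst2 G) - e c * e x * pderiv v = pderiv W.
Proof.
move=> SFF SFG Sc Sx c0 x1 FG res0.
have Scx : subst2_ok (mono (c * x) 0) := subst2_ok_mono 0 (SM Sc Sx).
pose A := F * derX der G; pose B := F * derY G - mono (c * x) 0.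
have SA : subst2_ok A by apply: subst2_okM => //; exact: subst2_ok_derX.
have SB : subst2_ok B.
  by apply: subst2_okD; [apply: subst2_okM => //; exact: subst2_ok_derY|exact: subst2_okN].
have AB : derY A = derX der B.
  rewrite /A /B (deriv_B (derX_derivation dD dM dr)) derX_mono // dM c0 x1.
  rewrite mul0r add0r mulr1 -FG (derYM hL) (derXM dD dM dr) (derXY dM dr).
  rewrite /brk; move: (derX der F) (derY F) (derX der G) (derY G) => a b c' d.
  move: (derY c') => f; ring.
have [W [SW XW YW]] := closed_form_exact SA SB AB res0.
exists (subst2 W); rewrite !subst2_pderiv // XW YW /A /B.
rewrite subst2D; [|by apply: subst2_okM => //; exact: subst2_ok_derY|exact: subst2_okN].
rewrite !subst2M //; try exact: subst2_ok_derX; try exact: subst2_ok_derY.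
have Ecx : subst2 (mono (c * x) 0) = e c * e x.
  by apply: (etrans (subst2_mono (c * x) 0)); rewrite expr0 mulr1 eM.
have Z : subst2 0 = 0 by rewrite -(mono_z0 _ 0%:R) subst2_mono e0 mul0r.
have -> : subst2 (- mono (c * x) 0) = - (e c * e x).
  by apply/eqP; rewrite -addr_eq0 -Ecx -(subst2D (subst2_okN Scx) Scx) addNr Z.
move: (subst2 F) (subst2 _) (subst2 _) (e c * e x) (pderiv v) => a b d f g; ring.
Qed.

End Potential.

End Substitution2.

(** * Residues after the substitution *)

Section ResidueSubst.
Variable K : fieldType.
Hypothesis hK : ratr_morph K.
Variable cp : K -> rat -> K.
Hypothesis hcp : scalar_powers cp.
Implicit Types (u v f : puiseux K) (F G : puiseux (puiseux K)).

Lemma res_subst2_neq0 F G u v J : u != 0 -> nat_exps F -> nat_exps G ->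
  (forall j, subst_ok u (F j)) -> (forall j, subst_ok u (G j)) ->
  brk (@pderiv K) F G = mono (mono J 0) 0 ->
  (forall j, (F * derX (@pderiv K) G) j (-1) = 0) ->
  (subst2 (subst cp u) v F * pderiv (subst2 (subst cp u) v G)) (-1)
    = J * (u * pderiv v) (-1).
Proof.
move=> u0 Fn Gn SF SG FG res0.
have hA := ratr_morph_puiseux hK.
pose S : puiseux K -> Prop := subst_ok u; pose e := subst cp u.
have eE c : e (mono c 0) = mono c 0.
  by rewrite /e subst_mono // (ppow0 hK hcp) // mulr1.
have er q : e (ratr q) = ratr q by rewrite ratr_mono eE.
have Sr q : S (ratr q) by rewrite ratr_mono; exact: subst_ok_mono.
have Sint f : S f -> f (-1) = 0 -> exists g, S g /\ pderiv g = f.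
  by move=> Sf f1; exists (integ f); split; [exact: subst_ok_integ|exact: pderiv_integ].
have ex : e (mono 1 1) = u.
  rewrite /e subst_mono // (ppow1 hK hcp) //; exact: mul1r.
have [W WE] := @subst2_form_exact _ _ hA hK (@pderiv K) (@pderivD K) (pderivM hK)
  (@pderiv_ratr K) S Sr (@subst_okN K u) (@subst_okD K u) (@subst_okM K u)
  (@subst_ok_pderiv K u) e (fun f g => @substD K cp u u0 f g)
  (fun f g => @substM K hK cp hcp u u0 f g)
  er (pderiv u) v (fun f => @subst_pderiv K hK cp hcp u u0 f)
  (fun f => f (-1) = 0) Sint F G (mono J 0) (mono 1 1) (conj Fn SF) (conj Gn SG)
  (@subst_ok_mono K u J 0) (@subst_ok_mono K u 1 1)
  (* The next two arguments state that J has derivative 0 and x has derivative 1. *)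
  (etrans (pderiv_mono J 0) (etrans (congr1 (fun x => mono (x * J) (0 - 1)) (ratrm0 K))
    (etrans (congr1 (fun x => mono x (0 - 1)) (mul0r J)) (mono_z0 _ _))))
  (etrans (pderiv_mono 1 1) (etrans (congr1 (fun x => mono (x * 1) (1 - 1)) (ratrm1 K))
    (congr2 (@mono K) (mul1r 1) (subrr 1)))) FG res0.
move/eqP: WE; rewrite subr_eq => /eqP ->.
rewrite coefD pderiv_residue add0r eE ex -mulrA coef_monoM subr0.
by [].
Qed.

(** Up to the nonzero factor n + 1 this is the derivative of v^(n+1). *)
Lemma res_expr_pderiv v n : (v ^+ n * pderiv v) (-1) = 0.
Proof.
have := pderiv_residue (v ^+ n.+1).
rewrite (deriv_X (pderiv_derivation hK)) /= -ratr_nat ratr_mono -mulrA coef_monoM subr0.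
move/eqP; rewrite mulf_eq0 ratrm_eq0 // pnatr_eq0 /=.
by move/eqP.
Qed.

Lemma subst_family0 f i : subst_family cp 0 f i = if i == 0 then mono (f 0) 0 else 0.
Proof.
rewrite /subst_family /ppow eqxx; case: eqP => [->|_]; last exact: mulr0.
exact: mulr1.
Qed.

(** By convention 0^a is 1 for a = 0 and 0 otherwise, so only the constant coefficient survives. *)
Lemma subst0 f : subst cp 0 f = mono (f 0) 0.
Proof.
have sf : summable (subst_family cp 0 f).
  split.
    exists 0, 1; split=> // k i; rewrite subst_family0.
    case: (k =P 0) => [_|_]; last by rewrite coef0 eqxx.
    rewrite monoE; case: (i =P 0) => [-> _|_]; last by rewrite eqxx.
    by exists 0%N; rewrite mul0r subr0.
  move=> i; apply: sub_finite_set (finite_set1 0) => k; rewrite /mkset subst_family0.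
  by case: (k =P 0) => // _; rewrite coef0 eqxx.
apply/puiseuxP => i; rewrite (psum_seq (r := [:: 0]) sf) //.
  by rewrite big_seq1 subst_family0 eqxx.
by move=> k; rewrite inE subst_family0 => /negPf ->; rewrite coef0.
Qed.

(** F(0, v) and G(0, v) are polynomials in v with scalar coefficients, and no v^n v' has a
    residue. *)
Lemma res_subst2_0 F G v :
  (subst2 (subst cp 0) v F * pderiv (subst2 (subst cp 0) v G)) (-1) = 0.
Proof.
have er q : subst cp 0 (ratr q) = ratr q.
  by rewrite subst0 [in LHS]ratr_mono monoE eqxx -ratr_mono.
have [N FN] := nat_exps_bound F; have [N' GN] := nat_exps_bound G.
rewrite (subst2E er v FN) (subst2E er v GN).
have pD := pderiv_derivation hK.
rewrite (big_morph _ (@pderivD K) (deriv_0 pD)) mulr_suml coef_sum big1 // => i _.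
rewrite mulr_sumr coef_sum big1 // => j _; rewrite !subst0.
rewrite (pderivM hK) pderiv_mono ratrm0 mul0r mono_z0 mul0r add0r.
rewrite mulrACA monoM addr0 coef_monoM subr0 (deriv_X pD).
case: (nat_of_ord j) => [|n]; first by rewrite !mul0r mulr0 coef0 mulr0.
have -> : v ^+ i * (n.+1%:R * v ^+ n.+1.-1 * pderiv v) = n.+1%:R * (v ^+ (i + n) * pderiv v).
  rewrite exprD /=; move: (v ^+ i) (v ^+ n) (pderiv v) => x y z; ring.
by rewrite -(ratr_nat (puiseux K) n.+1) ratr_mono coef_monoM subr0 res_expr_pderiv !mulr0.
Qed.

End ResidueSubst.

Theorem theorem3p6 (R : realType) (pw : R[i] -> rat -> R[i])
    (hpw : power_choice pw) :
  (* (1) *)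
  (forall (F G : serC R) (J : R[i]) (u v : serA R),
     jacobi_pair F G -> inAy F -> inAy G -> bracket F G = cst J ->
     (forall j : rat, (F * dX G) j (-1) = 0) ->
     int_exps u -> int_exps v ->
     (forall j : rat, substitutable pw (F j) u /\ substitutable pw (G j) u) ->
     (evalC pw F u v * pderiv (evalC pw G u v)) (-1)
       = J * (u * pderiv v) (-1)) /\
  (* (2) *)
  (forall F : serC R, inB F ->
     (jacobian_element F <->
        ~ (exists c : R[i], F = cst c) /\
        forall (a : rat) (c : R[i]), tr (powC pw (F - cst c) a) = 0)) /\
  (* (3) *)
  (forall F H : serC R, jacobian_element F -> inB H ->
     (~ const_leading F ->
        ((exists2 K : serC R, inB K & H = bracket K F) <->
         forall a : rat, tr (H * powC pw F a) = 0)) /\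
     ((exists2 K : serC R, inB K & H = bracket K F) <->
      forall (a : rat) (c : R[i]), tr (H * powC pw (F - cst c) a) = 0)) /\
  (* (4) *)
  (forall F G H : serC R, jacobi_pair F G -> bracket F G = 1 -> inB H ->
     tr (bracket H F * G) = tr H).
Proof.
have hC : ratr_morph R[i] := @ratr_morph_num R[i].
split; [|split; [|split]].
- move=> F G J u v _ Fn Gn FG res0 _ _ su.
  have [u0|u0] := eqVneq u 0.
    rewrite u0 mul0r coef0 mulr0.
    exact: (@res_subst2_0 R[i] hC pw F G v).
  have ok f : substitutable pw f u -> subst_ok u f.
    by case=> sf _; exact: (@subst_ok_of_summable R[i] pw hpw u u0 f sf).
  have Fok j : subst_ok u (F j) by apply: ok; case: (su j).
  have Gok j : subst_ok u (G j) by apply: ok; case: (su j).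
  exact: (@res_subst2_neq0 R[i] hC pw hpw F G u v J u0 Fn Gn Fok Gok FG res0).
- exact: (@jacobian_element_trace R[i] hC pw hpw).
- move=> F H [Fi [G Gi [J J0 FG]]] Hi.
  have Fc : ~ exists c, F = cst c := @not_const_of_brk R[i] F G J J0 FG.
  split=> [nc|]; last exact: (@brk_solvable_shift R[i] hC pw hpw F H Fi Hi Fc).
  have F0 : F != 0.
    apply: contra_notN Fc => /eqP ->; exists 0.
    exact: (esym (etrans (congr1 (fun z => mono z 0) (mono_z0 R[i] 0))
      (mono_z0 (serA R) 0))).
  apply: (@brk_solvable R[i] hC pw hpw F H Fi Hi); split=> //.
  have [d0|d0] := eqVneq (pdeg F) 0; last by left.
  by right; apply/eqP => e0; apply: nc.
- move=> F G H _ FG _; exact: (@brk_adjoint_trace R[i] hC F G H FG).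
Qed.
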